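(* Let $n,m\ge1$ and let $w\in a^{\le n}(ba^n)^*b\cup\{\epsilon\}$ be such that $wa^nba^m$ is a good word. Then (1) $\vdash^*_{\{wa^n,\,wa^nb\}}$ is a well quasi-order on $L^{\epsilon}_{\vdash_{\{wa^n,\,wa^nb\}}}$, and (2) $\vdash^*_{\{wa^nb,\,wa^nba^m\}}$ is a well quasi-order on $L^{\epsilon}_{\vdash_{\{wa^nb,\,wa^nba^m\}}}$.
   Context: For a set $X$ of words, $X^{\le n}=\bigcup_{i=0}^nX^i$. For words $u,v$, the shuffle $u \sqcup\!\sqcup v$ is the set of all words $u_1v_1\cdots u_kv_k$ with $k\ge 1$, $u=u_1\cdots u_k$, $v=v_1\cdots v_k$ (pieces possibly empty). For a finite set $I$ of words, $v \vdash_I w$ means $w \in v \sqcup\!\sqcup u$ for some $u\in I$; $\vdash_I^*$ is its reflexive-transitive closure and $L^{\epsilon}_{\vdash_I}=\{w : \epsilon \vdash_I^* w\}$. A quasi-order $\le$ on $S$ is a well quasi-order iff every infinite sequence in $S$ has $i<j$ with $s_i\le s_j$. Let $E$ exchange $a$ and $b$ and $\tilde w$ be the reversal of $w$; $w$ is bad if one of $w,\tilde w,E(w),E(\tilde w)$ has a factor $a^kb^h$ ($k,h\ge2$) or $a^kba^lb^{m'}$ ($k>l\ge1$, $m'\ge1$), and good otherwise. *)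

(* Defs.v *)
From Stdlib Require List.
From mathcomp Require Import all_boot.
From Stdlib Require Import Relation_Operators.

Set Implicit Arguments. Unset Strict Implicit. Unset Printing Implicit Defensive.

Inductive letter := la | lb.

Definition word := seq letter.

Definition apow (k : nat) : word := nseq k la.
Definition bpow (k : nat) : word := nseq k lb.

Definition in_shuffle (x u v : word) : Prop :=
  exists ps : seq (word * word),
    ps <> [::] /\
    u = flatten (map fst ps) /\
    v = flatten (map snd ps) /\
    x = flatten (map (fun p => p.1 ++ p.2) ps).

Definition step (I : seq word) (v w : word) : Prop :=
  exists u, List.In u I /\ in_shuffle w v u.

Definition derives (I : seq word) : word -> word -> Prop :=
  clos_refl_trans word (step I).

Definition Leps (I : seq word) (w : word) : Prop := derives I [::] w.

(* le is a well quasi-order on S (le is assumed/known to be a quasi-order;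
   the paper's criterion: every infinite sequence in S has i<j with s_i <= s_j) *)
Definition wqo_on (le : word -> word -> Prop) (S : word -> Prop) : Prop :=
  forall s : nat -> word, (forall i, S (s i)) ->
    exists i j, (i < j)%N /\ le (s i) (s j).

Definition factor (f v : word) : Prop := exists x y, v = x ++ f ++ y.

Definition swap_letter (c : letter) : letter := match c with la => lb | lb => la end.
Definition E (w : word) : word := map swap_letter w.

Definition has_bad_factor (v : word) : Prop :=
  (exists k h, (2 <= k)%N /\ (2 <= h)%N /\ factor (apow k ++ bpow h) v) \/
  (exists k l m', (l < k)%N /\ (1 <= l)%N /\ (1 <= m')%N /\
     factor (apow k ++ [:: lb] ++ apow l ++ bpow m') v).

Definition bad (w : word) : Prop :=
  has_bad_factor w \/ has_bad_factor (rev w) \/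
  has_bad_factor (E w) \/ has_bad_factor (E (rev w)).

Definition good (w : word) : Prop := ~ bad w.

Definition inW (n : nat) (w : word) : Prop :=
  w = [::] \/
  exists k j, (k <= n)%N /\
    w = apow k ++ flatten (nseq j (lb :: apow n)) ++ [:: lb].

(* Main.v *)
(* Write x = a^k (b a^n)^J for w a^n, so that the three words involved are x, xb and xba^m; goodness
   gives m <= n as soon as J > 0.  A word v is a shuffle of N copies of x, of which q1 are extended
   to xb and q2 of these to xba^m, iff its letter counts are right and each prefix with A letters a
   and B letters b satisfies
     k B <= A,   k N + n (B - N) <= A,   A <= k N + n B,   A <= (k + J n) N + m (B - J N)
   (the third only if J > 0): goodness is the convexity of this polygon.  Necessity holds because
   linear functionals are additive under shuffle; for sufficiency, serve the copies in a queue.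

   Cutting v after N, J N and J N + q2 letters b leaves four pieces, each a walk in a strip between
   two lines, of width at least N and of length O(N).  For one boundary line,
   a Kruskal-style argument shows that among infinitely many walks v_i staying above it, some v_j is
   a shuffle of an earlier v_i and of a walk above the line.  For two lines, either infinitely many
   of the walks can be cut into a part far from one line and a part far from the other, where each
   part needs only one constraint, or they all cross the strip in both directions, and cutting
   between two crossings leaves two walks that are shorter by a fixed fraction of the width;
   this recursion is finite because the length is O(N). *)
Require Import Defs.
From Stdlib Require Import ZArith Relation_Operators Operators_Properties.
From Stdlib Require Import Classical IndefiniteDescription.
From mathcomp Require Import all_boot.
From mathcomp Require Import zify.

Set Implicit Arguments. Unset Strict Implicit. Unset Printing Implicit Defensive.

#[local] Arguments Z.add : simpl never.
#[local] Arguments Z.sub : simpl never.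
#[local] Arguments Z.mul : simpl never.
#[local] Arguments Z.opp : simpl never.
#[local] Arguments Z.of_nat : simpl never.

(** * Almost-full relations and minimal bad sequences *)

Definition incr (phi : nat -> nat) := forall i j, i < j -> phi i < phi j.

(** Asking for a related pair in every subsequence, not only in the whole sequence, makes the notion
    stable under conjunction. *)
Definition af (R : nat -> nat -> Prop) :=
  forall phi, incr phi -> exists i j, i < j /\ R (phi i) (phi j).

Lemma incrS phi : (forall i, phi i < phi i.+1) -> incr phi.
Proof.
move=> H i; elim=> // j IH; rewrite ltnS leq_eqVlt => /orP[/eqP->//|/IH].
by move/ltn_trans; apply.
Qed.

Lemma incr_comp phi psi : incr phi -> incr psi -> incr (phi \o psi).
Proof. by move=> H1 H2 i j /H2 /H1. Qed.

Lemma incr_ge phi i : incr phi -> i <= phi i.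
Proof.
move=> H; elim: i => // i IH.
exact: leq_ltn_trans IH (H _ _ (ltnSn i)).
Qed.

Lemma af_pair R : af R -> exists i j, i < j /\ R i j.
Proof. by move/(_ id) => H; apply: H => i j. Qed.

Lemma af_sub R R' : (forall i j, i < j -> R i j -> R' i j) -> af R -> af R'.
Proof.
by move=> H HR phi Hphi; case: (HR _ Hphi) => i [j [ij r]]; exists i, j; split;
  last by apply: H r; apply: Hphi.
Qed.

Lemma af_comp R phi : incr phi -> af R -> af (fun i j => R (phi i) (phi j)).
Proof. by move=> H HR psi Hpsi; apply: (HR (phi \o psi)); apply: incr_comp. Qed.

Definition unbounded (X : nat -> Prop) := forall n, exists m, n <= m /\ X m.

Lemma not_unbounded X : ~ unbounded X -> exists n, forall m, n <= m -> ~ X m.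
Proof.
move=> /not_all_ex_not[n Hn]; exists n => m nm Xm; apply: Hn; by exists m.
Qed.

Lemma unbounded_enum X : unbounded X -> exists phi, incr phi /\ forall i, X (phi i).
Proof.
move=> H; case: (functional_choice _ H) => g Hg.
pose phi := fix phi i := if i is i'.+1 then g (phi i').+1 else g 0.
exists phi; split; first by apply: incrS => i /=; case: (Hg (phi i).+1).
by case=> [|i] /=; [case: (Hg 0) | case: (Hg (phi i).+1)].
Qed.

(** Infinite Ramsey argument: elements are picked one by one, each time shrinking the infinite set
    of candidates so that the pick is related to all of them or to none. Infinitely many picks of
    the second kind would form a subsequence without a related pair. *)
Lemma ramsey R : af R -> exists psi, incr psi /\ forall i j, i < j -> R (psi i) (psi j).
Proof.
move=> HR.
pose inf := {X | unbounded X}.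
have step (S : inf) : exists p : nat * inf,
    [/\ sval S p.1, forall y, sval p.2 y -> p.1 < y /\ sval S y &
     (forall y, sval p.2 y -> R p.1 y) \/ (forall y, sval p.2 y -> ~ R p.1 y)].
  case: S => X HX /=; case: (HX 0) => x [_ Xx].
  pose Y y := [/\ x < y, X y & R x y]; pose Y' y := [/\ x < y, X y & ~ R x y].
  case: (classic (unbounded Y)) => [HY|HY].
    exists (x, exist _ Y HY); split=> //=; first by move=> y [].
    by left=> y [].
  have HY' : unbounded Y'.
    case: (not_unbounded HY) => n Hn m; case: (HX (maxn m (maxn n x.+1))) => y [le Xy].
    exists y; split; first by lia.
    split=> //; first by lia.
    move=> Rxy; apply: (Hn y); first by lia.
    by split=> //; lia.
  exists (x, exist _ Y' HY'); split=> //=; first by move=> y [].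
  by right=> y [].
case: (functional_choice _ step) => g Hg.
have UT : unbounded (fun _ => True) by move=> n; exists n.
pose st := fix st i : inf := if i is i'.+1 then (g (st i')).2 else exist _ _ UT.
pose x i := (g (st i)).1.
have sub_st i d y : sval (st (i + d)) y -> sval (st i) y.
  elim: d y => [|d IH] y; first by rewrite addn0.
  by rewrite addnS /= => H; apply: IH; case: (Hg (st (i + d))) => _ H' _; case: (H' _ H).
have xin i j : i < j -> sval (st i.+1) (x j).
  by move=> ij; apply: (sub_st _ (j - i.+1)); rewrite subnKC //; case: (Hg (st j)).
have xinc : incr x.
  by move=> i j ij; case: (Hg (st i)) => _ H _; have [] := H _ (xin _ _ ij).
pose neg i := forall y, sval (st i.+1) y -> ~ R (x i) y.
case: (classic (unbounded neg)) => [/unbounded_enum[phi [Hphi Hneg]]|].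
  case: (HR (x \o phi)); first exact: incr_comp.
  by move=> i [j [/Hphi ij r]]; have := Hneg i _ (xin _ _ ij) r.
case/not_unbounded=> n Hn; exists (fun i => x (n + i)); split.
  by move=> i j ij; apply: xinc; rewrite ltn_add2l.
move=> i j ij; case: (Hg (st (n + i))) => _ _ [|H].
  by apply; apply: (xin (n + i) (n + j)); rewrite ltn_add2l.
by case: (Hn (n + i)); rewrite ?leq_addr.
Qed.

(** The first relation holds on all pairs of a Ramsey subsequence; the second is applied inside
    it. *)
Lemma af_and R R' : af R -> af R' -> af (fun i j => R i j /\ R' i j).
Proof.
move=> HR HR' phi Hphi.
case: (ramsey (af_comp Hphi HR)) => psi [Hpsi H].
case: (HR' _ (incr_comp Hphi Hpsi)) => i [j [ij r]].
by exists (psi i), (psi j); split; [exact: Hpsi | split; [exact: H |]].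
Qed.

Lemma af_forall (c : nat) (R : nat -> nat -> nat -> Prop) :
  (forall r, r < c -> af (R r)) -> af (fun i j => forall r, r < c -> R r i j).
Proof.
elim: c => [|c IH] H; first by move=> phi _; exists 0, 1.
apply: af_sub (af_and (IH (fun r rc => H r (ltnW rc))) (H c (ltnSn c))) => i j _ [H1 H2] r.
by rewrite ltnS leq_eqVlt => /orP[/eqP->//|/H1].
Qed.

Lemma af_leq (f : nat -> nat) : af (fun i j => f i <= f j).
Proof.
move=> phi Hphi.
suff H M : forall i, f (phi i) <= M -> exists i j, i < j /\ f (phi i) <= f (phi j).
  exact: (H _ 0 (leqnn _)).
elim: M => [|M IH] i Hi; first by exists i, i.+1; split=> //; apply: leq_trans Hi _.
case: (leqP (f (phi i)) (f (phi i.+1))) => [H|H]; first by exists i, i.+1.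
by apply: (IH i.+1); lia.
Qed.

Lemma af_bounded_eq M (f : nat -> nat) : (forall i, f i <= M) -> af (fun i j => f i = f j).
Proof.
move=> H; apply: af_sub (af_and (af_leq f) (af_leq (fun i => M - f i))) => i j _ [].
by move: (H i) (H j); lia.
Qed.

Lemma af_Zle (f : nat -> Z) : (forall i, 0 <= f i)%Z -> af (fun i j => (f i <= f j)%Z).
Proof.
move=> H; apply: af_sub (af_leq (fun i => Z.to_nat (f i))) => i j _.
by move: (H i) (H j); lia.
Qed.

Section MinimalBad.
Variables (T : Type) (mu : T -> nat) (R : T -> T -> Prop) (P : T -> Prop).

Definition bad_seq (s : nat -> T) :=
  (forall i, P (s i)) /\ forall i j, i < j -> ~ R (s i) (s j).

(** Dependent choice: stage [n] keeps the entries before [n] and minimises [mu] at entry [n] among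
    the bad sequences that agree so far. Entry [i] never changes after stage [i], so the diagonal is
    the limit. *)
Lemma minimal_bad s : bad_seq s ->
  exists d, bad_seq d /\
    forall t n, bad_seq t -> (forall i, i < n -> t i = d i) -> mu (d n) <= mu (t n).
Proof.
move=> Hs.
pose bs := {s | bad_seq s}.
have step (p : bs * nat) : exists t : bs,
    (forall i, i < p.2 -> sval t i = sval p.1 i) /\
    (forall t', bad_seq t' -> (forall i, i < p.2 -> t' i = sval p.1 i) ->
       mu (sval t p.2) <= mu (t' p.2)).
  case: p => -[u Hu] n /=; apply: NNPP => Hno.
  suff H M : forall t, bad_seq t -> (forall i, i < n -> t i = u i) -> mu (t n) <= M -> False.
    exact: (H _ u Hu _ (leqnn _)).
  elim: M => [|M IH] t Ht tu tM.
    apply: Hno; exists (exist _ t Ht); split=> //= t' _ _; exact: leq_trans tM _.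
  apply: Hno; exists (exist _ t Ht); split=> //= t' Ht' t'u.
  rewrite leqNgt; apply/negP => lt; apply: (IH t') => //.
  by rewrite -ltnS; apply: leq_trans lt tM.
case: (functional_choice _ step) => F HF.
pose S := fix S n := if n is n'.+1 then F (S n', n) else F (exist _ s Hs, 0).
have SS n k i : i <= n -> sval (S (n + k)) i = sval (S n) i.
  move=> le; elim: k => [|k IH]; first by rewrite addn0.
  rewrite addnS /=; case: (HF (S (n + k), (n + k).+1)) => /= E _.
  by rewrite E ?IH // ltnS; apply: leq_trans le (leq_addr _ _).
have SS' n m i : i <= n -> n <= m -> sval (S m) i = sval (S n) i.
  by move=> le nm; rewrite -(subnKC nm) SS.
exists (fun n => sval (S n) n); split.
  split=> [i|i j ij]; first by case: (svalP (S i)).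
  by rewrite -(SS' i j i) //; [case: (svalP (S j)) => _; apply | exact: ltnW].
move=> t [|n] Ht agree; first by case: (HF (exist _ s Hs, 0)) => _ /=; apply.
case: (HF (S n, n.+1)) => _ /=; apply=> // i le.
by rewrite agree // (SS' i n).
Qed.

End MinimalBad.

(** * Shuffles, and words with nonnegative suffix sums *)

(** A letter-by-letter form of [in_shuffle] over any alphabet, suited to induction. *)
Inductive shuf (T : Type) : seq T -> seq T -> seq T -> Prop :=
| shuf_nil : shuf [::] [::] [::]
| shuf_l x u v w : shuf u v w -> shuf (x :: u) v (x :: w)
| shuf_r x u v w : shuf u v w -> shuf u (x :: v) (x :: w).
#[local] Hint Constructors shuf : core.

Fixpoint zsum (T : Type) (f : T -> Z) (v : seq T) : Z :=
  if v is x :: v' then (f x + zsum f v')%Z else 0%Z.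

Section Shuffle.
Variable T : Type.
Implicit Types (u v w y : seq T) (f : T -> Z).

Lemma zsum_cat f u v : zsum f (u ++ v) = (zsum f u + zsum f v)%Z.
Proof. by elim: u => //= x u ->; lia. Qed.

Lemma zsum_rev f v : zsum f (rev v) = zsum f v.
Proof. by elim: v => //= x v IH; rewrite rev_cons -cats1 zsum_cat IH /=; lia. Qed.

Lemma zsum_take_drop f t v : (zsum f (take t v) + zsum f (drop t v) = zsum f v)%Z.
Proof. by rewrite -zsum_cat cat_take_drop. Qed.

Lemma shuf_sym u v w : shuf u v w -> shuf v u w.
Proof. by elim; auto. Qed.

Lemma shuf0l v : shuf [::] v v.
Proof. by elim: v; auto. Qed.

Lemma shuf0r v : shuf v [::] v.
Proof. by elim: v; auto. Qed.

Lemma shuf_cat u v w u' v' w' :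
  shuf u v w -> shuf u' v' w' -> shuf (u ++ u') (v ++ v') (w ++ w').
Proof. by elim=> //=; auto. Qed.

Lemma shuf_rev u v w : shuf u v w -> shuf (rev u) (rev v) (rev w).
Proof.
elim=> // x u' v' w' _ IH; rewrite !rev_cons -!cats1.
  by rewrite -[rev v']cats0; apply: shuf_cat IH _; auto.
by rewrite -[rev u']cats0; apply: shuf_cat IH _; auto.
Qed.

Lemma shuf_zsum f u v w : shuf u v w -> zsum f w = (zsum f u + zsum f v)%Z.
Proof. by elim=> //= *; lia. Qed.

Lemma shuf_size u v w : shuf u v w -> size w = size u + size v.
Proof. by elim=> //= *; lia. Qed.

Lemma shuf_take u v w : shuf u v w ->
  forall k, exists s t, shuf (take s u) (take t v) (take k w).
Proof.
elim=> [|x u' v' w' _ IH|x u' v' w' _ IH] k; first by exists 0, 0.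
  case: k => [|k]; first by exists 0, 0; rewrite !take0.
  by case: (IH k) => s [t H]; exists s.+1, t => /=; auto.
case: k => [|k]; first by exists 0, 0; rewrite !take0.
by case: (IH k) => s [t H]; exists s, t.+1 => /=; auto.
Qed.

(** A proper prefix of [v] is matched inside a proper prefix of [w]; [cut_pair] uses this to stay
    before a cut. *)
Lemma shuf_take_r u v w : shuf u v w -> forall t, exists s k,
  (t < size v -> k < size w) /\ shuf (take s u) (take t v) (take k w).
Proof.
move=> H t; case: (leqP (size v) t) => Ht.
  exists (size u), (size w); split; first by lia.
  by rewrite !take_oversize.
elim: H t Ht => //= x u' v' w' H IH t Ht.
  case: (IH _ Ht) => s [k [H1 H2]]; exists s.+1, k.+1; split; first by lia.
  by rewrite /=; auto.
case: t Ht => [|t] Ht; first by exists 0, 0; rewrite !take0.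
case: (IH t) => [|s [k [H1 H2]]]; first by lia.
by exists s, k.+1; split; [lia | rewrite /=; auto].
Qed.

Lemma shuf_assoc u v w z a : shuf u v a -> shuf a w z ->
  exists b, shuf v w b /\ shuf u b z.
Proof.
move=> H1 H2; elim: H2 u v H1 => {a w z} [|x a w z _ IH|x a w z _ IH] u v H.
- by inversion H; exists [::].
- inversion H as [|? u' ? ? H'|? ? v' ? H']; subst.
    by case: (IH _ _ H') => b [? ?]; exists b; auto.
  by case: (IH _ _ H') => b [? ?]; exists (x :: b); auto.
- by case: (IH _ _ H) => b [? ?]; exists (x :: b); auto.
Qed.

(** Suffix sums allow a decomposition from the first letter: a negative letter is paid for by what
    follows it. *)
Definition snneg f v := forall t, (0 <= zsum f (drop t v))%Z.

Lemma snneg_nil f : snneg f [::]. Proof. by []. Qed.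

Lemma snneg_cons f x v : snneg f (x :: v) <-> (0 <= f x + zsum f v)%Z /\ snneg f v.
Proof.
split=> [H|[H1 H2] [|t] //]; last exact: H2.
by split=> [|t]; [exact: (H 0) | exact: (H t.+1)].
Qed.

Lemma snneg_zsum f v : snneg f v -> (0 <= zsum f v)%Z.
Proof. by move/(_ 0); rewrite drop0. Qed.

Lemma snneg_cat f u v : snneg f u -> snneg f v -> snneg f (u ++ v).
Proof.
move=> + Hv; elim: u => //= x u IH /snneg_cons[H1 H2]; apply/snneg_cons.
by split; [rewrite zsum_cat; move: (snneg_zsum Hv); lia | exact: IH].
Qed.

Lemma snneg_catr f u v : snneg f (u ++ v) -> snneg f v.
Proof. by elim: u => //= x u IH /snneg_cons[_ /IH]. Qed.

Definition emb f v v' := exists y, shuf v y v' /\ snneg f y.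

Lemma emb0 f v : snneg f v -> emb f [::] v.
Proof. by exists v; split=> //; apply: shuf0l. Qed.

Lemma emb_refl f v : emb f v v.
Proof. by exists [::]; split; [apply: shuf0r | apply: snneg_nil]. Qed.

Lemma emb_cat f u u' v v' : emb f u u' -> emb f v v' -> emb f (u ++ v) (u' ++ v').
Proof.
move=> [y [H1 H2]] [y' [H1' H2']]; exists (y ++ y').
by split; [exact: shuf_cat | exact: snneg_cat].
Qed.

End Shuffle.

(** * A Kruskal-type theorem for words with nonnegative suffix sums *)

Section Kruskal.
Variables (T : Type) (up : T -> bool) (c : nat) (h : T -> Z).
Hypothesis hE : forall x, h x = if up x then 1%Z else (- Z.of_nat c)%Z.
Variables (code : T -> nat) (M : nat).
Hypotheses (code_le : forall x, code x <= M) (code_inj : injective code).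

(** Read from the right, the suffix sum climbs from 0 to [zsum h v] in upward steps of 1. The cut is
    at its last passage from [H - 1] to [H], after which it stays at least [H]. *)
Lemma last_passage v H : snneg h v -> (1 <= H <= zsum h v)%Z ->
  exists w a v', [/\ v = w ++ a :: v', up a, zsum h v' = (H - 1)%Z,
    snneg h w & zsum h w = (zsum h v - H)%Z].
Proof.
elim: v => [|x v IH] /=; first by lia.
move=> /snneg_cons[Hx Hv] HH; case: (Z_le_gt_dec H (zsum h v)) => HHv.
  case: IH => // [|w [a [v' [Ev ua E Hw Ew]]]]; first by lia.
  exists (x :: w), a, v'; split=> //=; [by rewrite Ev | | by lia].
  by apply/snneg_cons; split=> //; lia.
have ux : up x by move: HH; rewrite hE; case: (up x) => //; lia.
exists [::], x, v; move: (hE x); rewrite ux => Ex.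
by split=> //=; lia.
Qed.

Definition blocks (ps : seq (seq T * T)) := flatten [seq p.1 ++ [:: p.2] | p <- ps].

Definition good_block (p : seq T * T) := [/\ snneg h p.1, zsum h p.1 = 0%Z & up p.2].

Lemma zsum_blocks ps : List.Forall good_block ps -> zsum h (blocks ps) = Z.of_nat (size ps).
Proof.
elim=> //= p qs [_ E u] _; rewrite /blocks /= !zsum_cat -/(blocks qs) => ->.
by rewrite E /= hE u; lia.
Qed.

Lemma snneg_blocks ps : List.Forall good_block ps -> snneg h (blocks ps).
Proof.
elim=> [|p qs [H E u] _ IH]; first exact: snneg_nil.
rewrite /blocks /= -/(blocks qs); apply: snneg_cat => //; apply: snneg_cat => //.
by apply/snneg_cons; split; [rewrite hE u /=; lia | apply: snneg_nil].
Qed.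

Lemma blocks_decomp n v : snneg h v -> (Z.of_nat n <= zsum h v)%Z ->
  exists ps w, [/\ v = blocks ps ++ w, size ps = n, List.Forall good_block ps & snneg h w].
Proof.
elim: n v => [|n IH] v Hv Hn; first by exists [::], v.
(* Taking [H] to be the full sum makes the word before the up-letter sum to zero. *)
case: (@last_passage v (zsum h v)) => // [|w [a [v' [Ev ua E Hw Ew]]]]; first by lia.
have Hv' : snneg h v' by apply: (@snneg_catr _ _ (rcons w a)); rewrite cat_rcons -Ev.
rewrite Ev.
case: (IH v') => // [|ps [w0 [-> Es Hps Hw0]]]; first by lia.
exists ((w, a) :: ps), w0; split=> //=; first by rewrite /blocks /= -!catA.
  by rewrite Es.
by constructor=> //; split=> //=; lia.
Qed.

Lemma snneg_closed_blocks x ps : ~~ up x -> size ps = c -> List.Forall good_block ps ->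
  snneg h (x :: blocks ps).
Proof.
move=> ux Es Hps; apply/snneg_cons; split; last exact: snneg_blocks.
by rewrite hE (negbTE ux) zsum_blocks // Es; lia.
Qed.

(** A letter of weight [-c] is a tree node whose [c] subtrees are the block words, each followed by
    an up-letter paying one unit; an up-letter at the head is a leaf. *)
Definition decomp (v : seq T) (q : T * seq (seq T * T) * seq T) :=
  let: (x, ps, w) := q in
  [/\ v = x :: blocks ps ++ w, size ps = (if up x then 0 else c),
      List.Forall good_block ps & snneg h w].

Lemma decomp_ex v : v <> [::] -> snneg h v -> exists q, decomp v q.
Proof.
case: v => // x v _ /snneg_cons[Hx Hv].
have [|ps [w [E Es Hps Hw]]] := @blocks_decomp (if up x then 0 else c) v Hv.
  by move: Hx; rewrite hE; case: (up x) (snneg_zsum Hv); lia.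
by exists (x, ps, w); split=> //; rewrite E.
Qed.

Lemma snneg_head x ps : size ps = (if up x then 0 else c) -> List.Forall good_block ps ->
  snneg h (x :: blocks ps).
Proof.
case: (boolP (up x)) => ux Es Hps; last exact: snneg_closed_blocks.
by apply/snneg_cons; split; [rewrite hE ux zsum_blocks //; lia | exact: snneg_blocks].
Qed.

Lemma emb_rest v x ps w z : decomp v (x, ps, w) -> emb h z w -> emb h z v.
Proof.
move=> [-> Es Hps Hw] [y [H1 H2]]; exists ((x :: blocks ps) ++ y); split.
  exact: (shuf_cat (shuf0l (x :: blocks ps)) H1).
by apply: snneg_cat H2; apply: snneg_head.
Qed.

(** If the block word is a shuffle of [z] and [y], the word with [y] in its place is a valid
    leftover, since [y] sums to zero like the word it replaces. *)
Lemma emb_block v x ps w z r : snneg h z -> decomp v (x, ps, w) ->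
  emb h z (nth ([::], x) ps r).1 -> emb h z v.
Proof.
move=> Hz [-> Es Hps Hw]; case: (leqP (size ps) r) => Hr.
  (* An index past the end yields the empty default word, so [z] is empty. *)
  rewrite nth_default //= => -[y [H1 _]].
  have -> : z = [::] by move: (shuf_size H1); case: (z).
  apply: emb0; apply: (@snneg_cat _ _ (x :: blocks ps)) => //; exact: snneg_head.
set p := nth _ _ _ => -[y [H1 H2]].
have E : ps = take r ps ++ p :: drop r.+1 ps by rewrite -drop_nth // cat_take_drop.
move: Hps; rewrite {1}E => /List.Forall_app[Hp1 Hp2].
inversion Hp2 as [|? ? Hp Hp3]; subst; case: Hp => Hp4 Hp5 Hp6.
pose ps' := take r ps ++ (y, p.2) :: drop r.+1 ps.
have Ey : zsum h y = 0%Z.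
  by move: (shuf_zsum h H1) (snneg_zsum H2) (snneg_zsum Hz); lia.
exists ((x :: blocks ps') ++ w); split; last first.
  apply: snneg_cat => //; apply: snneg_head.
    by rewrite -Es {1}E /ps' !size_cat.
  by apply/List.Forall_app; split=> //; constructor.
rewrite {1}E /ps' /blocks !map_cat !flatten_cat /= -!catA.
apply: shuf_r; apply: (@shuf_cat _ [::]); first exact: shuf0l.
by rewrite -[z]cats0; apply: shuf_cat => //; apply: shuf0l.
Qed.

Lemma size_block v x ps w r : decomp v (x, ps, w) -> size (nth ([::], x) ps r).1 < size v.
Proof.
move=> [-> _ _ _]; case: (leqP (size ps) r) => Hr; first by rewrite nth_default.
have E : ps = take r ps ++ nth ([::], x) ps r :: drop r.+1 ps.
  by rewrite -drop_nth // cat_take_drop.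
by rewrite {2}E /blocks map_cat flatten_cat /= !size_cat /=; lia.
Qed.

Lemma snneg_block v x ps w r : decomp v (x, ps, w) -> snneg h (nth ([::], x) ps r).1.
Proof.
move=> [_ _ Hps _]; elim: Hps r => [|p qs [Hp _ _] _ IH] [|r] //=; exact: snneg_nil.
Qed.

Lemma emb_blocks p0 q0 ps qs : size ps = size qs ->
  (forall r, r < size ps -> emb h (nth p0 ps r).1 (nth q0 qs r).1 /\
                            (nth p0 ps r).2 = (nth q0 qs r).2) ->
  emb h (blocks ps) (blocks qs).
Proof.
elim: ps qs => [|p ps IH] [|q qs] //=; first by move=> _ _; apply: emb_refl.
case=> Es H; apply: emb_cat; last by apply: IH => // r; apply: (H r.+1).
by case: (H 0) => //= He ->; apply: emb_cat => //; apply: emb_refl.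
Qed.

(* Nash-Williams' minimal bad sequence argument, applied to the decompositions
   [a w] and [b w_1 a w_2 a ... w_c a w] of suffix-nonnegative words. *)
Lemma emb_pair (s : nat -> seq T) : (forall i, snneg h (s i)) ->
  exists i j, i < j /\ emb h (s i) (s j).
Proof.
move=> Hs; apply: NNPP => Hno.
have Hbad : bad_seq (emb h) (snneg h) s.
  by split=> // i j ij He; apply: Hno; exists i, j.
case: (minimal_bad size Hbad) => d [[Hd1 Hd2] Hmin].
have nonnil i : d i <> [::].
  by move=> E; apply: (Hd2 i i.+1) => //; rewrite E; apply: emb0.
have [q Hq] := functional_choice _ (fun i => decomp_ex (nonnil i) (Hd1 i)).
have key p : (forall i, size (p i) < size (d i)) -> (forall i, snneg h (p i)) ->
    (forall z i, snneg h z -> emb h z (p i) -> emb h z (d i)) ->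
    af (fun i j => emb h (p i) (p j)).
  move=> Hp1 Hp2 Hp3 phi Hphi; apply: NNPP => Hnop.
  (* From index [phi 0] on, [d] is replaced by the parts [p]. This sequence would be bad and yet
     smaller at [phi 0], against minimality. *)
  pose t i := if i < phi 0 then d i else p (phi (i - phi 0)).
  suff Ht : bad_seq (emb h) (snneg h) t.
    have := Hmin t (phi 0) Ht; rewrite /t ltnn subnn => Hle.
    have := Hp1 (phi 0); rewrite ltnNge => /negP; apply; apply: Hle => i.
    by rewrite /t => ->.
  split=> [i|i j ij]; first by rewrite /t; case: ifP.
  rewrite /t; case: (ltnP i (phi 0)) => Hi; case: (ltnP j (phi 0)) => Hj //.
  - exact: Hd2.
  - move=> He; apply: (Hd2 i (phi (j - phi 0))); last exact: Hp3 He.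
    apply: leq_trans Hi _; case: (j - phi 0) => // k; exact: ltnW (Hphi _ _ _).
  - by lia.
  move=> He; apply: Hnop; exists (i - phi 0), (j - phi 0); split=> //; lia.
pose X i := (q i).1.1; pose PS i := (q i).1.2; pose W i := (q i).2.
have HqE i : decomp (d i) (X i, PS i, W i) by move: (Hq i); rewrite /X /PS /W; case: (q i) => -[].
pose B i r := nth ([::], X i) (PS i) r.
(* [code] makes the alphabet finite, so equal letters can be arranged. *)
have afX : af (fun i j => code (X i) = code (X j)) by exact: (@af_bounded_eq M).
have afW : af (fun i j => emb h (W i) (W j)).
  apply: key => [i|i|z i _]; last exact: emb_rest (HqE i).
    by case: (HqE i) => E _ _ _; rewrite E /= size_cat; lia.
  by case: (HqE i).
have afB : af (fun i j => forall r, r < c ->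
    emb h (B i r).1 (B j r).1 /\ code (B i r).2 = code (B j r).2).
  apply: af_forall => r _; apply: af_and; last exact: (@af_bounded_eq M).
  apply: key => [i|i|z i Hz]; first exact: size_block (HqE i).
    exact: snneg_block (HqE i).
  exact: emb_block Hz (HqE i).
case: (af_pair (af_and afX (af_and afW afB))) => i [j [ij [/code_inj EX [HW HB]]]].
apply: (Hd2 i j ij); case: (HqE i) (HqE j) => -> Ei _ _ [-> Ej _ _].
rewrite EX; apply: (@emb_cat _ _ [:: X j] [:: X j]); first exact: emb_refl.
apply: emb_cat HW; apply: (@emb_blocks ([::], X i) ([::], X j)); first by rewrite Ei Ej EX.
move=> r Hr; case: (HB r) => [|? /code_inj ?]; last by split.
by move: Hr; rewrite Ei; case: (up _).
Qed.

End Kruskal.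

(** * Walks above one line *)

Section Walks.
Variable T : Type.
Implicit Types (u v w y : seq T) (f : T -> Z) (x : Z).

Definition nneg f x v := forall t, (0 <= x + zsum f (take t v))%Z.

Lemma nneg_ge0 f x v : nneg f x v -> (0 <= x)%Z.
Proof. by move/(_ 0); rewrite take0 /=; lia. Qed.

Lemma nneg_end f x v : nneg f x v -> (0 <= x + zsum f v)%Z.
Proof. by move/(_ (size v)); rewrite take_size. Qed.

Lemma nneg_nil f x : (0 <= x)%Z -> nneg f x [::].
Proof. by move=> H t /=; lia. Qed.

Lemma nneg_cat f x u v : nneg f x (u ++ v) <-> nneg f x u /\ nneg f (x + zsum f u) v.
Proof.
split=> [H|[H1 H2] t].
  split=> t; last by move: (H (size u + t)); rewrite take_cat ltnNge leq_addr addKn zsum_cat; lia.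
  case: (leqP t (size u)) => Ht; first by move: (H t); rewrite takel_cat.
  by rewrite take_oversize; [move: (H (size u)); rewrite take_size_cat | exact: ltnW].
rewrite take_cat; case: ifP => _; first exact: H1.
by rewrite zsum_cat; move: (H2 (t - size u)); lia.
Qed.

(** The start value is split along with the word: the leftover [y] is a walk above the same line,
    started from the surplus [x' - x]. *)
Definition walk_le f x v x' v' :=
  (x <= x')%Z /\ exists y, shuf v y v' /\ nneg f (x' - x) y.

Definition walk_wqo f := forall (x : nat -> Z) (v : nat -> seq T),
  (forall i, nneg f (x i) (v i)) -> af (fun i j => walk_le f (x i) (v i) (x j) (v j)).

End Walks.

(** With [A] letters [a] and [B] letters [b] read, these are the increments of the slacks [A - c B]
    and [d B - A] with respect to a lower and an upper line. *)
Definition lower_weight (c : nat) (x : letter) : Z :=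
  match x with la => 1%Z | lb => (- Z.of_nat c)%Z end.
Definition upper_weight (d : nat) (x : letter) : Z :=
  match x with la => (-1)%Z | lb => Z.of_nat d end.

Lemma zsum_upper d v : zsum (upper_weight d) v = (- zsum (lower_weight d) v)%Z.
Proof. by elim: v => //= -[] v -> /=; lia. Qed.

(** * One boundary line: reduction to suffix sums *)

Section Slack.
Variable c : nat.
Let f := lower_weight c.

(* A starting slack of [k] is encoded as [k] extra up-letters [None] at the end of the word. *)
Let pad k v := map Some v ++ nseq k (@None letter).
Let h (x : option letter) := if x is Some x then f x else 1%Z.
Let unpad (w : seq (option letter)) := pmap id w.

Lemma shuf_unpad u v w : shuf u v w -> shuf (unpad u) (unpad v) (unpad w).
Proof. by elim=> //= -[x|] //= *; auto. Qed.

Lemma unpad_pad k v : unpad (pad k v) = v.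
Proof. by elim: v => /= [|x v ->] //; elim: k. Qed.

Lemma zsum_h k v : zsum h (pad k v) = (zsum f v + Z.of_nat k)%Z.
Proof. by elim: v => /= [|x v ->]; [elim: k => //= k ->; lia | lia]. Qed.

Lemma shuf_pad u y k v : shuf u y (pad k v) -> exists l y', y = pad l y'.
Proof.
elim: v u y => [|x v IH] u y.
  suff H w : shuf u y w -> w = nseq k None -> exists l, y = nseq l None.
    by move=> /H[//|l ->]; exists l, [::].
  move=> H; elim: H k => {u y w} [|x u y w _ IH|x u y w _ IH] [|k] //=; first by exists 0.
    by case=> _ /IH.
  by case=> -> /IH[l ->]; exists l.+1.
move=> H; inversion H as [|? ? ? ? H'|? ? ? ? H']; subst; first exact: IH H'.
by case: (IH _ _ H') => l [y' ->]; exists l, (x :: y').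
Qed.

Lemma snneg_pad k v : snneg h (pad k v) <-> forall t, (0 <= Z.of_nat k + zsum f (drop t v))%Z.
Proof.
elim: v => [|x v IH]; split=> H.
- by move=> t /=; lia.
- move=> t; elim: k t {H} => [|k IH] t; first by case: t. 
  case: t => [|t]; last exact: (IH t).
  by rewrite drop0 zsum_h /=; lia.
- case/snneg_cons: H => H1 /IH H2 [|t]; last exact: H2.
  by move: H1; rewrite zsum_h /=; lia.
apply/snneg_cons; split; last by apply/IH => t; exact: (H t.+1).
by move: (H 0); rewrite zsum_h /=; lia.
Qed.

Lemma suffix_wqo (k : nat -> nat) (v : nat -> seq letter) :
  (forall i t, (0 <= Z.of_nat (k i) + zsum f (drop t (v i)))%Z) ->
  af (fun i j => k i <= k j /\ exists y, shuf (v i) y (v j) /\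
        forall t, (0 <= Z.of_nat (k j) - Z.of_nat (k i) + zsum f (drop t y))%Z).
Proof.
move=> H phi _.
pose up (x : option letter) := if x is Some lb then false else true.
pose code (x : option letter) := match x with None => 0 | Some la => 1 | Some lb => 2 end.
have [||||i [j [ij [Y [HY nY]]]]] :=
    @emb_pair _ up c h _ code 2 _ _ (fun i => pad (k (phi i)) (v (phi i))).
- by case=> // -[].
- by case=> // -[].
- by case=> [[]|] [[]|].
- by move=> i; apply/snneg_pad.
exists i, j; split=> //; case: (shuf_pad HY) => l [y E]; subst Y.
have Hy : shuf (v (phi i)) y (v (phi j)) by move: (shuf_unpad HY); rewrite !unpad_pad.
have El : k (phi j) = k (phi i) + l.
  by move: (shuf_zsum h HY) (shuf_zsum f Hy); rewrite !zsum_h; lia.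
split; first by lia.
by exists y; split=> // t; move/snneg_pad: nY => /(_ t); lia.
Qed.

(** Reversal turns prefix sums into suffix sums, and the start value becomes the padding. *)
Lemma lower_wqo : walk_wqo f.
Proof.
move=> x v H.
have x0 i := nneg_ge0 (H i).
apply: af_sub (@suffix_wqo (fun i => Z.to_nat (x i)) (fun i => rev (v i)) _) => [i j _|i t].
  case=> le [y [/shuf_rev Hy Ny]]; rewrite !revK in Hy.
  split; first by move: (x0 i) (x0 j); lia.
  exists (rev y); split=> // t; move: (Ny (size y - t)) (x0 i) (x0 j).
  by rewrite take_rev zsum_rev; lia.
by move: (H i (size (v i) - t)) (x0 i); rewrite drop_rev zsum_rev; lia.
Qed.

(** Read backwards, the slack [d B - A] grows by 1 at each [a]. Hence the suffix version applies
    without reversal, with the final slack [e] as padding. *)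
Lemma upper_wqo : walk_wqo (upper_weight c).
Proof.
move=> x v H.
have e0 i := nneg_end (H i).
pose e i := (x i + zsum (upper_weight c) (v i))%Z.
apply: af_sub (@suffix_wqo (fun i => Z.to_nat (e i)) v _) => [i j _|i t].
  case=> le [y [Hy Ny]].
  have Ny' : nneg (upper_weight c) (x j - x i) y.
    move=> t; move: (Ny t) (zsum_take_drop (upper_weight c) t y) (shuf_zsum (upper_weight c) Hy).
    by move: (e0 i) (e0 j); rewrite /e !(zsum_upper c (drop _ _)) /f; lia.
  split; last by exists y.
  by move: (nneg_ge0 Ny'); lia.
move: (H i t) (zsum_take_drop (upper_weight c) t (v i)) (e0 i).
by rewrite /e (zsum_upper c (drop _ _)) /f; lia.
Qed.

End Slack.

(** * Walks between two lines *)

Section TwoSlacks.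
Variables (T : Type) (f : bool -> T -> Z) (C : nat).
Hypothesis C_gt0 : 0 < C.
Hypothesis f_le : forall b x, (- Z.of_nat C <= f b x <= Z.of_nat C)%Z.
Hypothesis f_wqo : forall b, walk_wqo (f b).

Implicit Types (X : bool -> Z) (v : seq T) (b : bool).

Definition band X v := forall b, nneg (f b) (X b) v.
Definition sl X v b t := (X b + zsum (f b) (take t v))%Z.
(** The sum of the two slacks is the width of the strip at that point. *)
Definition wide (D : Z) X v := forall t, (D <= sl X v true t + sl X v false t)%Z.
Definition after X u b := (X b + zsum (f b) u)%Z.
Definition band_le X v X' v' := (forall b, X b <= X' b)%Z /\
  exists y, shuf v y v' /\ band (fun b => X' b - X b)%Z y.

Lemma band_cat X u v : band X (u ++ v) <-> band X u /\ band (after X u) v.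
Proof.
split=> [H|[H1 H2] b]; last by apply/nneg_cat; split; [exact: H1 | exact: H2].
by split=> b; case/nneg_cat: (H b).
Qed.

Lemma after_sub X X' u u' y b : shuf u y u' ->
  (after X' u' b - after X u b = X' b - X b + zsum (f b) y)%Z.
Proof. by move/(shuf_zsum (f b)); rewrite /after; lia. Qed.

Lemma band_le_cat X u v X' u' v' :
  band_le X u X' u' -> band_le (after X u) v (after X' u') v' ->
  band_le X (u ++ v) X' (u' ++ v').
Proof.
move=> [le [y [Hy Ny]]] [le' [z [Hz Nz]]]; split=> //.
exists (y ++ z); split; first exact: shuf_cat.
apply/band_cat; split=> // b t; move: (Nz b t); rewrite (after_sub _ _ _ Hy).
by rewrite /after; lia.
Qed.

Lemma zsum_lip b v s t : s <= t ->
  (zsum (f b) (take s v) - zsum (f b) (take t v) <= Z.of_nat C * Z.of_nat (t - s))%Z.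
Proof.
elim: v s t => [|x v IH] s t; first by move=> _ /=; nia.
case: s t => [|s] [|t] //=; try by move=> _; nia.
  by move=> _; move: (IH 0 t isT) (f_le b x); rewrite take0 /=; nia.
by move=> st; move: (IH s t st); rewrite subSS; lia.
Qed.

Lemma sl_bound X v : exists M : nat, forall b t, (sl X v b t <= Z.of_nat M)%Z.
Proof.
suff [M HM] : exists M : nat, forall b t, (zsum (f b) (take t v) <= Z.of_nat M)%Z.
  exists (M + Z.to_nat (X true) + Z.to_nat (X false)) => b t.
  by move: (HM b t); rewrite /sl; case: b; lia.
exists (C * size v) => b t.
elim: (v) t => [|x w IH] t; first by rewrite /=; lia.
case: t => [|t] /=; first by lia.
by move: (IH t) (f_le b x); lia.
Qed.

(* Before the cut [t] only the slack [b] can be small, from [t] on only the slack [~~ b]. *)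
Definition cut b G X v := exists t,
  (forall s, s < t -> s <= size v -> (G <= sl X v (~~ b) s)%Z) /\
  (forall s, t <= s -> s <= size v -> (G <= sl X v b s)%Z).

Lemma sl_after X v t s b : sl (after X (take t v)) (drop t v) b s = sl X v b (t + s).
Proof. by rewrite /sl /after takeD zsum_cat; lia. Qed.

(** Each side of the cut is embedded with respect to the one line that can be near. The other line
    is respected by the leftover because the later word is far from it, by more than any slack of
    the fixed earlier word. *)
Lemma cut_pair b (X : nat -> bool -> Z) (v : nat -> seq T) :
  (forall i, band (X i) (v i)) ->
  (forall G, exists i, G <= i /\ cut b (Z.of_nat G) (X i) (v i)) ->
  exists i j, i < j /\ band_le (X i) (v i) (X j) (v j).
Proof.
move=> HB Hcut.
have [I HI] := functional_choice _ Hcut.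
have [t Ht] := functional_choice _ (fun G => (HI G).2).
pose u G := take (t G) (v (I G)); pose w G := drop (t G) (v (I G)).
pose Y G := after (X (I G)) (u G).
have HBuw G : band (X (I G)) (u G) /\ band (Y G) (w G).
  by apply/band_cat; rewrite cat_take_drop.
have A1 := @f_wqo b (fun G => X (I G) b) u (fun G => (HBuw G).1 b).
have A2 := @f_wqo (~~ b) (fun G => Y G (~~ b)) w (fun G => (HBuw G).2 (~~ b)).
have A3 := @af_Zle (fun G => X (I G) (~~ b)) (fun G => nneg_ge0 ((HBuw G).1 (~~ b))).
case: (ramsey (af_and A1 (af_and A2 A3))) => psi [Hpsi H].
set g := psi 0; have [M HM] := sl_bound (X (I g)) (v (I g)).
(* The later word is chosen only after the bound [M] on the slacks of the earlier one is known. *)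
pose h := psi (maxn M (I g)).+1.
have Mh : M <= h by move: (incr_ge (maxn M (I g)).+1 Hpsi); rewrite -/h; lia.
have gh : I g < I h by move: (HI h).1 (incr_ge (maxn M (I g)).+1 Hpsi); rewrite -/h; lia.
case: (H 0 (maxn M (I g)).+1 isT) => -[le1 [y1 [Hy1 Ny1]]] [[le2 [y2 [Hy2 Ny2]]] le3].
rewrite -/g -/h in le1 Hy1 Ny1 le2 Hy2 Ny2 le3.
case: (Ht h) => Hh1 Hh2.
have Eu s : zsum (f (~~ b)) (take s (u h)) = zsum (f (~~ b)) (take (minn s (t h)) (v (I h))).
  by rewrite /u take_min.
have N1 : band (fun b => X (I h) b - X (I g) b)%Z y1.
  move=> b'; case: (eqVneq b' b) => [->//|nb] s.
  have {b' nb}-> : b' = ~~ b by move: nb; case: (b'); case: (b).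
  (* The whole of [y1] is handled by the start slack of the second part; a proper prefix of it ends
     before the cut, where the slack is at least [h]. *)
  case: (leqP (size y1) s) => Hs.
    by rewrite take_oversize // -(after_sub _ _ _ Hy1); move: le2; rewrite /Y; lia.
  case: (shuf_take_r Hy1 s) => s1 [k [/(_ Hs) Hk /(shuf_zsum (f (~~ b))) E]].
  have Hk' : k < t h /\ k <= size (v (I h))
    by move: Hk; rewrite /u size_take_min; lia.
  move: (Hh1 k Hk'.1 Hk'.2) (HM (~~ b) (minn s1 (t g))) E; rewrite Eu /sl /u -take_min.
  by rewrite (minn_idPl (ltnW Hk'.1)); lia.
have N2 : band (fun b => Y h b - Y g b)%Z y2.
  move=> b'; case: (eqVneq b' (~~ b)) => [->//|nb] s.
  have {b' nb}-> : b' = b by move: nb; case: (b'); case: (b).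
  have E0 : (0 <= Y h b - Y g b)%Z.
    by rewrite (after_sub _ _ _ Hy1); apply: nneg_end.
  case: (shuf_take_r Hy2 s) => s1 [k [_ /(shuf_zsum (f b)) E]].
  (* A cut at or beyond the end of the word leaves an empty second part. *)
  case: (leqP (size (v (I h))) (t h)) => Hth.
    have wh : w h = [::] by rewrite /w drop_oversize.
    have -> : y2 = [::] by move: (shuf_size Hy2); rewrite wh; case: (y2) => //= *; lia.
    by rewrite /=; lia.
  pose k' := minn k (size (w h)).
  have Ek : take k (w h) = take k' (w h).
    by rewrite /k'; case: leqP => // /ltnW Hk; rewrite take_oversize ?take_size.
  have Hk' : t h + k' <= size (v (I h)) by rewrite /k' /w size_drop; lia.
  move: (Hh2 _ (leq_addr _ _) Hk') (HM b (t g + s1)) E.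
  by rewrite -!sl_after Ek /sl -/(u h) -/(w h) -/(u g) -/(w g) -/(Y g) -/(Y h); lia.
exists (I g), (I h); split=> //.
rewrite -(cat_take_drop (t g) (v (I g))) -(cat_take_drop (t h) (v (I h))).
apply: band_le_cat; split.
- by move=> b'; move: (nneg_ge0 (N1 b')); lia.
- by exists y1.
- by move=> b'; move: (nneg_ge0 (N2 b')); rewrite /Y /u; lia.
- by exists y2.
Qed.

(** Otherwise a cut would exist at the first position where the slack [~~ b] is below [G], or beyond
    the end if there is none. *)
Lemma no_cut b G X v : ~ cut b G X v ->
  exists t0 t1, [/\ t0 <= t1, t1 <= size v, (sl X v (~~ b) t0 < G)%Z & (sl X v b t1 < G)%Z].
Proof.
move=> Hno; apply: NNPP => Hnp.
suff H n : n <= (size v).+1 -> forall s, s < n -> (G <= sl X v (~~ b) s)%Z.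
  by apply: Hno; exists (size v).+1; split=> s Hs Hs'; [exact: (H _ (leqnn _)) | lia].
elim: n => // n IH Hn s; rewrite ltnS leq_eqVlt => /orP[/eqP->|]; last by apply: IH; lia.
case: (Z_le_gt_dec G (sl X v (~~ b) n)) => // Hlt; case: Hno; exists n; split.
  by move=> s' Hs' _; apply: IH => //; lia.
move=> s' Hs' Hs''; case: (Z_le_gt_dec G (sl X v b s')) => // Hlt'.
by case: Hnp; exists n, s'; split=> //; lia.
Qed.

(** At [t0] the slack [b] exceeds [D - G], at [t1] it is below [G], and one letter changes it by at
    most [C]. *)
Lemma crossing b D G X v t0 t1 : wide D X v -> t0 <= t1 ->
  (sl X v (~~ b) t0 < G)%Z -> (sl X v b t1 < G)%Z ->
  (D - 2 * G <= Z.of_nat C * Z.of_nat (t1 - t0))%Z.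
Proof.
move=> /(_ t0) W le H0 H1; move: (@zsum_lip b v _ _ le).
by case: b H0 H1 => /= H0 H1; move: W H0 H1; rewrite /sl; lia.
Qed.

(* The band is crossed in both directions; cutting at the start of the later crossing leaves
   one crossing on each side. *)
Lemma split_point D G X v : wide D X v -> (forall b, ~ cut b G X v) ->
  exists t, t <= size v /\
   (Z.of_nat C * Z.of_nat (size (take t v)) <=
      Z.of_nat C * Z.of_nat (size v) - (D - 2 * G))%Z /\
   (Z.of_nat C * Z.of_nat (size (drop t v)) <=
      Z.of_nat C * Z.of_nat (size v) - (D - 2 * G))%Z.
Proof.
move=> W Hno.
case: (no_cut (Hno true)) => t0 [t1 [le1 s1 H0 H1]].
case: (no_cut (Hno false)) => t0' [t1' [le1' s1' H0' H1']].
have c1 := crossing W le1 H0 H1; have c1' := crossing W le1' H0' H1'.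
case: (leqP t0 t0') => [le|/ltnW le].
  have c2 := @crossing true _ _ _ _ _ _ W le H0 H0'.
  exists t0'; rewrite size_take size_drop; split; first by lia.
  by split; [case: ltnP; nia | nia].
have c2 := @crossing false _ _ _ _ _ _ W le H0' H0.
exists t0; rewrite size_take size_drop; split; first by lia.
by split; [case: ltnP; nia | nia].
Qed.

Lemma wide_cat D X u v : wide D X (u ++ v) -> wide D X u /\ wide D (after X u) v.
Proof.
move=> W; split=> t.
  case: (leqP t (size u)) => Ht; first by move: (W t); rewrite /sl takel_cat.
  rewrite /sl take_oversize; last exact: ltnW.
  by move: (W (size u)); rewrite /sl take_size_cat.
by move: (W (size u + t)); rewrite /sl /after take_cat ltnNge leq_addr addKn !zsum_cat; lia.
Qed.

(** Induction on [L], which bounds the length in units of the width. Without cuts, [split_point]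
    takes [D - 2 G] off [C] times the length of each half, so [L] drops by one and [K] grows by
    [2 G]. *)
Lemma band_pair (L : nat) : forall (K : nat) (X : nat -> bool -> Z) (v : nat -> seq T)
  (D : nat -> Z),
  (forall i, band (X i) (v i)) -> (forall i, wide (D i) (X i) (v i)) ->
  (forall i, Z.of_nat C * Z.of_nat (size (v i)) <= Z.of_nat L * D i + Z.of_nat K)%Z ->
  exists i j, i < j /\ band_le (X i) (v i) (X j) (v j).
Proof.
elim: L => [|L IH] K X v D HB HW HL.
  have A1 := f_wqo (fun i => HB i true).
  have A2 := af_Zle (fun i => nneg_ge0 (HB i false)).
  (* For [L = 0] the sizes are at most [K]; a pair with nonincreasing size has an empty leftover. *)
  have A3 := af_leq (fun i => K - size (v i)).
  case: (af_pair (af_and A1 (af_and A2 A3))) => i [j [ij [[le [y [Hy _]]] [le' Hs]]]].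
  have Hj : (size (v j) <= K) by move: (HL j) C_gt0; nia.
  have y0 : y = [::] by move: (shuf_size Hy) Hs Hj; case: (y) => //= *; lia.
  exists i, j; split=> //; split; first by case.
  by exists [::]; rewrite -y0; split=> //; rewrite y0 => -[]; apply: nneg_nil; lia.
pose many b := forall G, exists i, G <= i /\ cut b (Z.of_nat G) (X i) (v i).
case: (classic (exists b, many b)) => [[b]|Hfew]; first exact: cut_pair.
have few b : exists G0, forall G i, G0 <= G -> G0 <= i -> ~ cut b (Z.of_nat G) (X i) (v i).
  have : ~ many b by move=> Hb; apply: Hfew; exists b.
  (* A cut for a larger bound is also a cut for [G0]. *)
  move/not_all_ex_not=> [G0 HG0]; exists G0 => G i leG lei [t [Hc1 Hc2]].
  apply: HG0; exists i; split=> //; exists t; split=> s Hs Hs'.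
    by move: (Hc1 s Hs Hs'); lia.
  by move: (Hc2 s Hs Hs'); lia.
case: (few true) => G1 HG1; case: (few false) => G2 HG2.
pose G := maxn G1 G2.
have nocut i : forall b, ~ cut b (Z.of_nat G) (X (G + i)) (v (G + i)).
  by case; [apply: HG1 | apply: HG2]; rewrite /G; lia.
have [t Ht] := functional_choice _ (fun i => split_point (HW (G + i)) (nocut i)).
pose u i := take (t i) (v (G + i)); pose w i := drop (t i) (v (G + i)).
pose Y i := after (X (G + i)) (u i).
have HB' i : band (X (G + i)) (u i) /\ band (Y i) (w i) by apply/band_cat; rewrite cat_take_drop.
have HW' i : wide (D (G + i)) (X (G + i)) (u i) /\ wide (D (G + i)) (Y i) (w i).
  by apply: wide_cat; rewrite cat_take_drop.
have af_u : af (fun i j => band_le (X (G + i)) (u i) (X (G + j)) (u j)).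
  move=> phi _; apply: (IH (K + 2 * G) (fun i => X (G + phi i)) (fun i => u (phi i))
    (fun i => D (G + phi i))) => i; first exact: (HB' _).1.
    exact: (HW' _).1.
  by case: (Ht (phi i)) => _ [+ _]; move: (HL (G + phi i)); rewrite /u; lia.
have af_w : af (fun i j => band_le (Y i) (w i) (Y j) (w j)).
  move=> phi _; apply: (IH (K + 2 * G) (fun i => Y (phi i)) (fun i => w (phi i))
    (fun i => D (G + phi i))) => i; first exact: (HB' _).2.
    exact: (HW' _).2.
  by case: (Ht (phi i)) => _ [_ +]; move: (HL (G + phi i)); rewrite /w; lia.
case: (af_pair (af_and af_u af_w)) => i [j [ij [H1 H2]]].
exists (G + i), (G + j); split; first by rewrite ltn_add2l.
rewrite -(cat_take_drop (t i) (v (G + i))) -(cat_take_drop (t j) (v (G + j))).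
exact: band_le_cat H1 H2.
Qed.

Lemma band_wqo (L K : nat) (X : nat -> bool -> Z) (v : nat -> seq T) (D : nat -> Z) :
  (forall i, band (X i) (v i)) -> (forall i, wide (D i) (X i) (v i)) ->
  (forall i, Z.of_nat C * Z.of_nat (size (v i)) <= Z.of_nat L * D i + Z.of_nat K)%Z ->
  af (fun i j => band_le (X i) (v i) (X j) (v j)).
Proof.
move=> HB HW HL phi _.
exact: (@band_pair L K (fun i => X (phi i)) (fun i => v (phi i)) (fun i => D (phi i))).
Qed.

End TwoSlacks.

(** * Shuffle closure and queues *)

Lemma in_shuffle_shuf w v u : in_shuffle w v u -> shuf v u w.
Proof.
case=> ps [_ [-> [-> ->]]]; elim: ps => //= -[p q] ps IH.
apply: shuf_cat IH; have := shuf_cat (shuf0r p) (shuf0l q).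
by rewrite cats0.
Qed.

Lemma shuf_in_shuffle w v u : shuf v u w -> in_shuffle w v u.
Proof.
elim=> [|x u' v' w' _ [ps [_ [-> [-> ->]]]]|x u' v' w' _ [ps [_ [-> [-> ->]]]]].
- by exists [:: ([::], [::])].
- by exists (([:: x], [::]) :: ps).
- by exists (([::], [:: x]) :: ps).
Qed.

Lemma Leps_ind I (Q : word -> Prop) : Q [::] ->
  (forall z u v, Q z -> List.In u I -> shuf z u v -> Q v) ->
  forall v, Leps I v -> Q v.
Proof.
move=> Q0 QS v; rewrite /Leps /derives => Hd.
have {}Hd := clos_rt_rtn1 _ _ _ _ Hd; elim: Hd => // z w [u [Hu /in_shuffle_shuf Hs]] _ IH.
exact: QS IH Hu Hs.
Qed.

Inductive shufs : seq word -> word -> Prop :=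
| shufs_nil : shufs [::] [::]
| shufs_cons u us w0 w : shufs us w0 -> shuf u w0 w -> shufs (u :: us) w.

Lemma shuf_assoc' T (u v w a z : seq T) : shuf v w a -> shuf u a z ->
  exists b, shuf u v b /\ shuf b w z.
Proof.
move=> /shuf_sym H1 /shuf_sym H2; case: (shuf_assoc H1 H2) => b [Hb Hz].
by exists b; split; apply: shuf_sym.
Qed.

Lemma derives_shufs I us y : shufs us y -> (forall u, List.In u us -> List.In u I) ->
  forall v v', shuf v y v' -> derives I v v'.
Proof.
elim=> {us y} [|u us w0 w _ IH Hw] HI v v' Hv.
  have -> : v' = v; last exact: rt_refl.
  by move: Hv; move E: [::] => z H; elim: H E => // x u a b _ IH E; rewrite IH.
case: (shuf_assoc' Hw Hv) => b [Hb Hv']; apply: rt_trans (IH _ b v' Hv').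
  by apply: rt_step; exists u; split; [apply: HI; left | apply: shuf_in_shuffle].
by move=> u' Hu'; apply: HI; right.
Qed.

Lemma shufs_rcons us u y : shufs (rcons us u) y -> shufs (u :: us) y.
Proof.
elim: us y => //= u1 us IH y H; inversion H as [|? ? w0 ? H1 H2]; subst; have {}H1 := IH _ H1.
inversion H1 as [|? ? w1 ? H3 H4]; subst.
case: (shuf_assoc' H4 H2) => b [/shuf_sym Hb Hy].
case: (shuf_assoc Hb Hy) => b' [Hb' Hy'].
exact: shufs_cons (shufs_cons H3 Hb') Hy'.
Qed.

(* A queue entry [(s, t)] is a copy that still has to read [s] letters [a], then [t]; the queue has
   so far received [al] letters [a], which go to the first entries that are not served. *)
Fixpoint pend (Q : seq (nat * word)) (al : nat) : seq word :=
  if Q is (s, t) :: Q' then (apow (s - al) ++ t) :: pend Q' (al - s) else [::].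

Definition demand (Q : seq (nat * word)) := sumn (map fst Q).

Lemma pend_a Q al y : al < demand Q -> shufs (pend Q al.+1) y -> shufs (pend Q al) (la :: y).
Proof.
elim: Q al y => // -[s t] Q IH al y; rewrite /demand /= => Hal H.
inversion H as [|? ? w0 ? H1 H2]; subst; case: (ltnP al s) => Has.
  have E : s - al = (s - al.+1).+1 by lia.
  have E' : al.+1 - s = al - s by lia.
  by rewrite E; rewrite E' in H1; apply: shufs_cons H1 _; rewrite /=; auto.
have E : s - al.+1 = s - al by lia.
have E' : al.+1 - s = (al - s).+1 by lia.
rewrite E in H2; rewrite E' in H1; apply: (shufs_cons (w0 := la :: w0)); last by auto.
by apply: IH H1; rewrite /demand; lia.
Qed.

Lemma pend_rcons Q e al : al <= demand Q ->
  pend (rcons Q e) al = rcons (pend Q al) (apow e.1 ++ e.2).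
Proof.
elim: Q al => [|[s t] Q IH] al; rewrite /demand /=.
  by case: e => s t; rewrite leqn0 => /eqP->; rewrite subn0.
by move=> H; rewrite IH // /demand; lia.
Qed.

Lemma pend_b Q s s' t' al y : s <= al -> al - s <= demand Q ->
  shufs (pend (rcons Q (s', t')) (al - s)) y ->
  shufs (pend ((s, lb :: apow s' ++ t') :: Q) al) (lb :: y).
Proof.
move=> Hs Hal; rewrite pend_rcons // => /shufs_rcons H; inversion H as [|? ? w0 ? H1 H2]; subst.
have E : s - al = 0 by lia.
by rewrite /= E /=; apply: shufs_cons H1 _; apply: shuf_l.
Qed.

Lemma pend_done Q : (forall e, List.In e Q -> e.2 = [::]) -> shufs (pend Q (demand Q)) [::].
Proof.
elim: Q => [|[s t] Q IH] H; first exact: shufs_nil.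
rewrite /demand /=; have -> : s - (s + sumn (map fst Q)) = 0 by lia.
have /= -> := H (s, t) (or_introl erefl); rewrite addKn.
by apply: shufs_cons (IH _) _ => [e He|]; [apply: H; right | apply: shuf_nil].
Qed.

Definition na (v : word) : Z := zsum (fun x => if x is la then 1%Z else 0%Z) v.
Definition nb (v : word) : Z := zsum (fun x => if x is lb then 1%Z else 0%Z) v.

Section Queue.
Variables (N Bt : nat) (s : nat -> nat) (t : nat -> word) (S : nat -> nat).
Hypothesis N_gt0 : 0 < N.
Hypothesis S_step : forall i, S i.+1 = S i + s i.
Hypothesis t_step : forall i, i < Bt -> t i = lb :: apow (s (i + N)) ++ t (i + N).
Hypothesis t_end : forall i, Bt <= i -> t i = [::].

(** Entries are numbered by arrival: after [B] letters [b] those from [B] to [B + N - 1] are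
    waiting. [S] gives the accumulated demand. *)
Let queue B := [seq (s i, t i) | i <- iota B N].

Lemma demand_queue M B :
  S B + sumn (map fst [seq (s i, t i) | i <- iota B M]) = S (B + M).
Proof.
elim: M B => [|M IH] B /=; first by rewrite addn0 addn0.
by rewrite addnA -S_step IH addSnnS.
Qed.

(** [S B + al] is the number of letters [a] read so far. It must reach [S B'] so that each departing
    head is served, and must not exceed [S (B' + N)], all that has been demanded. *)
Lemma queue_run y B al :
  (Z.of_nat B + nb y = Z.of_nat Bt)%Z ->
  (Z.of_nat (S B) + Z.of_nat al + na y = Z.of_nat (S (Bt + N)))%Z ->
  (forall l, exists B', Z.of_nat B' = (Z.of_nat B + nb (take l y))%Z /\
     (Z.of_nat (S B') <= Z.of_nat (S B) + Z.of_nat al + na (take l y)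
        <= Z.of_nat (S (B' + N)))%Z) ->
  shufs (pend (queue B) al) y.
Proof.
elim: y B al => [|x y IH] B al.
  rewrite /nb /na /= => HB Hal _; have E : B = Bt by lia.
  have -> : al = demand (queue B).
    by move: (demand_queue N B) Hal; rewrite -E /demand /queue; lia.
  apply: pend_done => e /List.in_map_iff[i [<-]] /= /List.in_seq Hi.
  by apply: t_end; lia.
move=> HB Hal H; case: (H 0) => B0 []; rewrite /nb /na /= => EB0 H0.
have {EB0} E0 : B0 = B by lia.
subst B0; case: (H 1) => B1 []; rewrite /nb /na /= take0 /= => EB1 H1.
have step al' B' : (Z.of_nat B' = Z.of_nat B + nb [:: x])%Z ->
    (Z.of_nat (S B') + Z.of_nat al' = Z.of_nat (S B) + Z.of_nat al + na [:: x])%Z ->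
    shufs (pend (queue B') al') y.
  move=> E1 E2; apply: IH.
  - by move: HB E1; rewrite /nb /=; lia.
  - by move: Hal E2; rewrite /na /=; lia.
  move=> l; case: (H l.+1) => B2 [E3 E4]; exists B2; move: E1 E2 E3 E4.
  by rewrite /nb /na /=; lia.
case: x HB Hal H EB1 H1 step => /= HB Hal H EB1 H1 step.
  have E1 : B1 = B by lia.
  subst B1; apply: pend_a; last by apply: step; rewrite /nb /na /=; lia.
  by move: (demand_queue N B); rewrite /demand /queue; lia.
have E1 : B1 = B.+1 by lia.
subst B1; rewrite S_step in H1.
have HBt : B < Bt.
  have : (0 <= nb y)%Z by rewrite /nb; elim: (y) => //= -[] ? ?; lia.
  by move: HB; rewrite /nb /=; lia.
pose Q := [seq (s i, t i) | i <- iota B.+1 N.-1].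
have EQ : queue B = (s B, t B) :: Q by rewrite /queue -{1}(prednK N_gt0).
have ER : rcons Q (s (B + N), t (B + N)) = queue B.+1.
  have EN : iota B.+1 N = iota B.+1 (N.-1 + 1) by congr iota; lia.
  rewrite /queue EN iotaD map_cat /= cats1 -/Q.
  by have -> : B.+1 + N.-1 = B + N by lia.
have Hd := demand_queue N B; rewrite -/(queue B) EQ /= in Hd.
rewrite -/(queue B) EQ t_step //; apply: pend_b; [lia | rewrite /demand; lia |].
by rewrite ER; apply: step; rewrite /nb /na /= ?S_step; lia.
Qed.

End Queue.

(** * The prefix inequalities *)

Lemma na_ge0 v : (0 <= na v)%Z.
Proof. by rewrite /na; elim: v => //= -[] v; lia. Qed.

Lemma nb_ge0 v : (0 <= nb v)%Z.
Proof. by rewrite /nb; elim: v => //= -[] v; lia. Qed.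

Lemma size_na_nb v : Z.of_nat (size v) = (na v + nb v)%Z.
Proof. by rewrite /na /nb; elim: v => //= -[] v; lia. Qed.

Lemma zsum_ab f v : zsum f v = (na v * f la + nb v * f lb)%Z.
Proof. by rewrite /na /nb; elim: v => //= -[] v ->; lia. Qed.

Lemma na_cat u v : na (u ++ v) = (na u + na v)%Z. Proof. exact: zsum_cat. Qed.
Lemma nb_cat u v : nb (u ++ v) = (nb u + nb v)%Z. Proof. exact: zsum_cat. Qed.

Lemma na_take_drop t v : (na (take t v) + na (drop t v))%Z = na v.
Proof. exact: zsum_take_drop. Qed.
Lemma nb_take_drop t v : (nb (take t v) + nb (drop t v))%Z = nb v.
Proof. exact: zsum_take_drop. Qed.

Lemma shuf_na u v w : shuf u v w -> na w = (na u + na v)%Z. Proof. exact: shuf_zsum. Qed.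
Lemma shuf_nb u v w : shuf u v w -> nb w = (nb u + nb v)%Z. Proof. exact: shuf_zsum. Qed.

Lemma zsum_apow f k : zsum f (apow k) = (Z.of_nat k * f la)%Z.
Proof. by rewrite /apow; elim: k => //= k ->; lia. Qed.

Lemma zsum_rep f J (blk : word) : zsum f (flatten (nseq J blk)) = (Z.of_nat J * zsum f blk)%Z.
Proof. by elim: J => //= J IH; rewrite zsum_cat IH; lia. Qed.

Lemma nneg_cons f x c (v : word) : (0 <= x)%Z -> nneg f (x + f c) v -> nneg f x (c :: v).
Proof. by move=> Hx H [|t] /=; [lia | move: (H t); lia]. Qed.

Lemma nneg_apow f x k : (0 <= x)%Z -> (0 <= x + Z.of_nat k * f la)%Z -> nneg f x (apow k).
Proof.
move=> H1 H2 t; have -> : take t (apow k) = apow (minn t k).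
  rewrite /apow; case: (leqP t k) => H; first by rewrite take_nseq.
  by rewrite take_oversize // size_nseq ltnW.
by rewrite zsum_apow; case: (Z_le_gt_dec 0 (f la)) => H; case: (leqP t k) => Ht; nia.
Qed.

Lemma nneg_rep f x J (blk : word) : (0 <= x)%Z ->
  (forall i, i < J -> nneg f (x + Z.of_nat i * zsum f blk) blk) ->
  nneg f x (flatten (nseq J blk)).
Proof.
elim: J x => [|J IH] x Hx H; first exact: nneg_nil.
have H0 : nneg f x blk by move: (H 0 isT); rewrite Z.mul_0_l Z.add_0_r.
apply/nneg_cat; split=> //; apply: IH; first exact: nneg_end.
move=> i Hi; have := H i.+1 Hi; congr nneg; lia.
Qed.

(** For [b = 0] the cut is at the very start, which keeps the first two pieces empty when
    [J = 0]. *)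
Lemma split_nb b v : (Z.of_nat b <= nb v)%Z ->
  exists u w, [/\ v = u ++ w, nb u = Z.of_nat b & b = 0 -> u = [::]].
Proof.
elim: v b => [|x v IH] b Hb.
  by exists [::], [::]; split=> //; move: Hb; rewrite /nb /=; lia.
case: b Hb => [|b] Hb; first by exists [::], (x :: v).
case: x Hb => Hb.
  case: (IH b.+1) => [|u [w [-> Eu _]]]; first by move: Hb; rewrite /nb /=; lia.
  by exists (la :: u), w; split=> //; rewrite -Eu /nb /=; lia.
case: (IH b) => [|u [w [-> Eu _]]]; first by move: Hb; rewrite /nb /=; lia.
by exists (lb :: u), w; split=> //; move: Eu; rewrite /nb /=; lia.
Qed.

(** * Shuffles of copies characterised by letter counts and prefix inequalities *)

Section Language.
Variables (k n J m : nat).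
Hypotheses (n_gt0 : 0 < n) (m_gt0 : 0 < m).
Hypotheses (k_J0 : J = 0 -> k = n) (le_J : 0 < J -> k <= n /\ m <= n).

Definition stem := apow k ++ flatten (nseq J (lb :: apow n)).

Local Notation zk := (Z.of_nat k).
Local Notation zn := (Z.of_nat n).
Local Notation zJ := (Z.of_nat J).
Local Notation zm := (Z.of_nat m).

(** The inequalities are homogeneous in [(N, A, B)] and so add up under shuffle. For [J = 0] the
    third could fail when [m > n]. *)
Definition region (N A B : Z) :=
  [/\ (zk * B <= A)%Z, (zk * N + zn * (B - N) <= A)%Z,
      0 < J -> (A <= zk * N + zn * B)%Z &
      (A <= (zk + zJ * zn) * N + zm * (B - zJ * N))%Z].

(** The two languages of the theorem are the cases [q2 = 0] and [q1 = N]. *)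
Definition inlang (N q1 q2 : nat) v :=
  [/\ q2 <= q1 <= N, na v = ((zk + zJ * zn) * Z.of_nat N + zm * Z.of_nat q2)%Z,
      nb v = (zJ * Z.of_nat N + Z.of_nat q1)%Z &
      forall t, region (Z.of_nat N) (na (take t v)) (nb (take t v))].

(** A slack is monotone along a run of letters [a], so it is enough to check the ends of runs. *)
Lemma nneg_full f x : (0 <= x)%Z -> (0 <= x + zk * f la)%Z ->
  (forall i, i < J -> let z := (x + zk * f la + Z.of_nat i * (f lb + zn * f la))%Z in
     (0 <= z /\ 0 <= z + f lb /\ 0 <= z + f lb + zn * f la)%Z) ->
  let z := (x + zk * f la + zJ * (f lb + zn * f la))%Z in
  (0 <= z + f lb)%Z -> (0 <= z + f lb + zm * f la)%Z ->
  nneg f x (stem ++ lb :: apow m).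
Proof.
move=> H1 H2 HJ z H3 H4; rewrite /stem -catA; apply/nneg_cat; split; first exact: nneg_apow.
rewrite zsum_apow; apply/nneg_cat; split.
  apply: nneg_rep => // i /HJ[H5 [H6 H7]]; rewrite /= zsum_apow.
  by apply: nneg_cons => //; apply: nneg_apow.
rewrite zsum_rep /= zsum_apow; have Hz : (0 <= z)%Z.
  rewrite /z; case: (posnP J) => [->|J0]; first by lia.
  case: (HJ J.-1) => [|_ [_ H]]; first by lia.
  by have -> : zJ = (Z.of_nat J.-1 + 1)%Z; lia.
by apply: nneg_cons => //; apply: nneg_apow.
Qed.

Lemma region_full t :
  region 1 (na (take t (stem ++ lb :: apow m))) (nb (take t (stem ++ lb :: apow m))).
Proof.
set v := stem ++ _.
have lw c x : nneg (lower_weight c) x v -> (Z.of_nat c * nb (take t v) <= x + na (take t v))%Z.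
  by move/(_ t); rewrite zsum_ab /=; lia.
have uw d x : nneg (upper_weight d) x v -> (na (take t v) <= x + Z.of_nat d * nb (take t v))%Z.
  by move/(_ t); rewrite zsum_ab /=; lia.
have kn : k <= n by case: (posnP J) => [/k_J0->|/le_J[]].
split.
- suff /lw : nneg (lower_weight k) 0 v by lia.
  by apply: nneg_full => /= [||i Hi||]; nia.
- suff /lw : nneg (lower_weight n) (zn - zk) v by lia.
  by apply: nneg_full => /= [||i Hi||]; nia.
- move=> /le_J[_ mn]; suff /uw : nneg (upper_weight n) zk v by lia.
  by apply: nneg_full => /= [||i Hi||]; nia.
suff /uw : nneg (upper_weight m) (zk + zJ * zn - zJ * zm) v by lia.
have HJ : J = 0 \/ 0 < J /\ m <= n by case: (posnP J) => [->|H]; [left | right; case: (le_J H)].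
by apply: nneg_full => /= [||i Hi||]; case: HJ => [HJ|[HJ mn]]; nia.
Qed.

Lemma region_prefix u : (exists w, stem ++ lb :: apow m = u ++ w) ->
  forall t, region 1 (na (take t u)) (nb (take t u)).
Proof.
case=> w E t; have := region_full (minn t (size u)); rewrite E takel_cat ?geq_minr //.
by rewrite take_min take_size.
Qed.

Lemma na_stem : na stem = (zk + zJ * zn)%Z.
Proof. by rewrite /na /stem zsum_cat zsum_apow zsum_rep /= zsum_apow; lia. Qed.

Lemma nb_stem : nb stem = zJ.
Proof. by rewrite /nb /stem zsum_cat zsum_apow zsum_rep /= zsum_apow; lia. Qed.

Lemma inlang_stem : inlang 1 0 0 stem.
Proof.
split=> //; first by rewrite na_stem; lia.
  by rewrite nb_stem; lia.
by apply: region_prefix; exists (lb :: apow m).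
Qed.

Lemma inlang_stem_b : inlang 1 1 0 (stem ++ [:: lb]).
Proof.
split=> //; first by rewrite na_cat na_stem /na /=; lia.
  by rewrite nb_cat nb_stem /nb /=; lia.
by apply: region_prefix; exists (apow m); rewrite -catA.
Qed.

Lemma inlang_stem_ba : inlang 1 1 1 (stem ++ lb :: apow m).
Proof.
split=> //; first by rewrite na_cat na_stem /na /= zsum_apow; lia.
  by rewrite nb_cat nb_stem /nb /= zsum_apow; lia.
exact: region_full.
Qed.

Lemma inlang0 : inlang 0 0 0 [::].
Proof.
by split=> // [||t]; rewrite /na /nb /=; [lia | lia | split=> *; lia].
Qed.

Lemma inlang_shuf N q1 q2 N' q1' q2' u v w : inlang N q1 q2 u -> inlang N' q1' q2' v ->
  shuf u v w -> inlang (N + N') (q1 + q1') (q2 + q2') w.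
Proof.
move=> [H1 H2 H3 H4] [H1' H2' H3' H4'] H; split.
- by lia.
- by rewrite (shuf_na H) H2 H2'; lia.
- by rewrite (shuf_nb H) H3 H3'; lia.
move=> t; case: (shuf_take H t) => s [s' Ht].
rewrite (shuf_na Ht) (shuf_nb Ht); case: (H4 s) (H4' s') => [R1 R2 R3 R4] [R1' R2' R3' R4'].
by split=> [|| J0 |]; [lia | lia | move: (R3 J0) (R3' J0); lia | lia].
Qed.

(** Sufficiency of the inequalities: they are the hypotheses of [queue_run] for a queue of [N]
    copies. *)
Lemma inlang_shufs N q1 q2 y : inlang N q1 q2 y -> exists us, shufs us y /\
  forall u, List.In u us -> [\/ u = stem ++ lb :: apow m /\ 0 < q2,
     u = stem ++ [:: lb] /\ q2 < q1 | u = stem /\ q1 < N].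
Proof.
case=> Hq Ha Hb HR; case: (posnP N) => [N0|N_gt0].
  exists [::]; split=> //; have : Z.of_nat (size y) = 0%Z by rewrite size_na_nb; nia.
  by case: (y) => [_|? ? /=]; [exact: shufs_nil | lia].
pose JN := J * N.
(* Runs arrive in stages: [N] runs [a^k], then [J N] runs [a^n], then [q2] runs [a^m], then empty
   ones. Entry [i] is copy [i %% N] at stage [i %/ N]. *)
pose s i := if i < N then k else if i < N + JN then n else if i < N + JN + q2 then m else 0.
pose S i := k * minn i N + n * minn (i - N) JN + m * minn (i - (N + JN)) q2.
pose fin c := if c < q2 then lb :: apow m else if c < q1 then [:: lb] else [::].
pose t i := if i %/ N <= J then flatten (nseq (J - i %/ N) (lb :: apow n)) ++ fin (i %% N)
            else [::].
have S_step i : S i.+1 = S i + s i.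
  rewrite /S /s.
  have -> : minn i.+1 N = minn i N + (i < N) by lia.
  have -> : minn (i.+1 - N) JN = minn (i - N) JN + (N <= i < N + JN) by lia.
  have -> : minn (i.+1 - (N + JN)) q2 = minn (i - (N + JN)) q2 + (N + JN <= i < N + JN + q2).
    by lia.
  rewrite !mulnDr; case: (ltnP i N) => H1.
    have -> : (N + JN <= i < N + JN + q2) = false by lia.
    by rewrite /=; lia.
  case: (ltnP i (N + JN)) => H2; first by rewrite /=; lia.
  by rewrite /=; case: (ltnP i (N + JN + q2)) => H3; lia.
have JNE : Z.of_nat JN = (zJ * Z.of_nat N)%Z by rewrite /JN; lia.
have div_lt i : (i %/ N < J) = (i < JN) by rewrite ltn_divLR.
have divS i : (i + N) %/ N = (i %/ N).+1 by rewrite divnDr // divnn N_gt0 addn1.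
have modS i : (i + N) %% N = i %% N by rewrite modnDr.
have div_eq i : JN <= i < JN + N -> i %/ N = J /\ i %% N = i - JN.
  move=> Hi; have -> : i = J * N + (i - JN) by rewrite /JN in Hi *; lia.
  by rewrite divnMDl // modnMDl divn_small ?modn_small /JN; lia.
have t_step i : i < JN + q1 -> t i = lb :: apow (s (i + N)) ++ t (i + N).
  move=> Hi; rewrite /t divS modS; case: (ltnP i JN) => HiJ.
    have HJ : i %/ N < J by rewrite div_lt.
    have -> : s (i + N) = n.
      rewrite /s; have -> : (i + N < N) = false by lia.
      by have -> : i + N < N + JN by lia.
    by rewrite ltnW // HJ subnS -{1}(prednK (_ : 0 < J - i %/ N)) ?subn_gt0 //= -catA.
  have [-> ->] : i %/ N = J /\ i %% N = i - JN by apply: div_eq; lia.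
  rewrite leqnn ltnn subnn cats0 /= /fin /s; case: (ltnP (i - JN) q2) => H2.
    have -> : (i + N < N) = false by lia.
    have -> : (i + N < N + JN) = false by lia.
    by have -> : (i + N < N + JN + q2) by lia.
  have -> : (i + N < N) = false by lia.
  have -> : (i + N < N + JN) = false by lia.
  have -> : (i + N < N + JN + q2) = false by lia.
  by have -> : i - JN < q1 by lia.
have t_end i : JN + q1 <= i -> t i = [::].
  move=> Hi; rewrite /t; case: ltnP => // HJ.
  have HJ' : i < JN + N by move: HJ; rewrite -ltnS ltn_divLR // mulSn /JN; lia.
  have [-> ->] : i %/ N = J /\ i %% N = i - JN by apply: div_eq; lia.
  rewrite subnn /= /fin.
  have -> : (i - JN < q2) = false by lia.
  by have -> : (i - JN < q1) = false by lia.
have Send : S (JN + q1 + N) = k * N + n * JN + m * q2.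
  by rewrite /S; congr (_ * _ + _ * _ + _ * _); lia.
have HQ := queue_run N_gt0 S_step t_step t_end (y := y) (B := 0) (al := 0).
exists (pend [seq (s i, t i) | i <- iota 0 N] 0); split.
  apply: HQ; first by rewrite Hb; lia.
    by rewrite Send Ha /S; lia.
  move=> l; have Hl := @nb_ge0 (take l y); have Hl' := nb_take_drop l y.
  have Hr := @nb_ge0 (drop l y); have Har := @na_ge0 (drop l y); have Hal := na_take_drop l y.
  set b := Z.to_nat (nb (take l y)); exists b; split; first by lia.
  case: (HR l); have -> : nb (take l y) = Z.of_nat b by lia.
  set A := na _ in Hal *; have S0 : S 0 = 0 by rewrite /S; lia.
  rewrite S0 => R1 R2 R3 R4; have Hb' : b <= JN + q1 by lia.
  split.
    (* The lower bound is the first inequality up to [N] letters [b], the second beyond. *)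
    rewrite /S; have -> : minn (b - (N + JN)) q2 = 0 by lia.
    have -> : minn (b - N) JN = b - N by lia.
    case: (leqP b N) => HbN; last by nia.
    have -> : b - N = 0 by lia.
    by lia.
  (* The upper bound is the third inequality, then the fourth, and at the end the total number of
     letters [a]. *)
  rewrite /S; have -> : minn (b + N) N = N by lia.
  have -> : b + N - (N + JN) = b - JN by lia.
  rewrite addnK; case: (leqP b JN) => HbJ.
    have -> : b - JN = 0 by lia.
    case: (posnP J) => [J0|/R3]; last by lia.
    have b0 : b = 0 by move: HbJ; rewrite /JN J0; lia.
    by move: R4; rewrite b0 J0; lia.
  by case: (leqP q2 (b - JN)) => Hq2; nia.
move=> u; have Hpend M i0 : pend [seq (s i, t i) | i <- iota i0 M] 0 =
    [seq apow (s i) ++ t i | i <- iota i0 M].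
  by elim: M i0 => //= M IH i0; rewrite subn0 sub0n IH.
rewrite Hpend => /List.in_map_iff[i [<-]] /List.in_seq Hi.
have HiN : i < N by lia.
rewrite /s HiN /t divn_small // modn_small //= subn0 catA -/stem /fin.
case: (ltnP i q2) => H1; first by apply: Or31; split=> //; lia.
case: (ltnP i q1) => H2; first by apply: Or32; split=> //; lia.
by rewrite cats0; apply: Or33; split=> //; lia.
Qed.

End Language.

(** * Cutting into four strips *)

Definition strip (c d : nat) (X Y : Z) (v : word) := forall t,
  (Z.of_nat c * nb (take t v) <= X + na (take t v))%Z /\
  (na (take t v) <= Y + Z.of_nat d * nb (take t v))%Z.

Definition strip_le c d X Y v X' Y' v' := [/\ (X <= X')%Z, (Y <= Y')%Z &
  exists y, shuf v y v' /\ strip c d (X' - X) (Y' - Y) y].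

Lemma strip_wqo c d L (X Y : nat -> Z) (v : nat -> word) (N : nat -> nat) :
  (forall i, strip c d (X i) (Y i) (v i)) ->
  (forall i t, (Z.of_nat (N i) <= X i + Y i +
     (Z.of_nat d - Z.of_nat c) * nb (take t (v i)))%Z) ->
  (forall i, size (v i) <= L * N i) ->
  af (fun i j => strip_le c d (X i) (Y i) (v i) (X j) (Y j) (v j)).
Proof.
move=> HS HW HL.
pose f (b : bool) := if b then lower_weight c else upper_weight d.
pose Z i (b : bool) := if b then X i else Y i.
have f_le b x : (- Z.of_nat (c + d).+1 <= f b x <= Z.of_nat (c + d).+1)%Z.
  by case: b; case: x => /=; lia.
have f_wqo b : walk_wqo (f b) by case: b; [apply: lower_wqo | apply: upper_wqo].
have HB : forall i, band f (Z i) (v i).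
  by move=> i [] t /=; rewrite zsum_ab /=; case: (HS i t); lia.
have HW' : forall i, wide f (Z.of_nat (N i)) (Z i) (v i).
  by move=> i t; rewrite /sl !zsum_ab /=; move: (HW i t); lia.
have := @band_wqo _ f (c + d).+1 isT f_le f_wqo ((c + d).+1 * L) 0 Z v _ HB HW' _.
move=> H; apply: af_sub (H _) => [i j _|i]; last by move: (HL i); nia.
case=> le [y [Hy By]]; split; [exact: (le true) | exact: (le false) |].
exists y; split=> // t; move: (By true t) (By false t); rewrite /= !zsum_ab /=; lia.
Qed.

Lemma take_cat4 (p1 p2 p3 p4 : word) t : exists t',
  [\/ take t (p1 ++ p2 ++ p3 ++ p4) = take t' p1,
      take t (p1 ++ p2 ++ p3 ++ p4) = p1 ++ take t' p2,
      take t (p1 ++ p2 ++ p3 ++ p4) = p1 ++ p2 ++ take t' p3 |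
      take t (p1 ++ p2 ++ p3 ++ p4) = p1 ++ p2 ++ p3 ++ take t' p4].
Proof.
rewrite take_cat; case: ltnP => _; first by exists t; apply: Or41.
rewrite take_cat; case: ltnP => _; first by exists (t - size p1); apply: Or42.
rewrite take_cat; case: ltnP => _; first by exists (t - size p1 - size p2); apply: Or43.
by exists (t - size p1 - size p2 - size p3); apply: Or44.
Qed.

Section Pieces.
Variables (k n J m : nat).
Hypotheses (n_gt0 : 0 < n) (m_gt0 : 0 < m).
Hypotheses (k_J0 : J = 0 -> k = n) (le_J : 0 < J -> k <= n /\ m <= n).

Local Notation zk := (Z.of_nat k).
Local Notation zn := (Z.of_nat n).
Local Notation zJ := (Z.of_nat J).
Local Notation zm := (Z.of_nat m).
Local Notation inlang := (inlang k n J m).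
Local Notation region := (region k n J m).

(* Number of letters [b] in the first piece; for [J = 0] the first two pieces are empty. *)
Definition cut1 (N : nat) := if J is 0 then 0 else N.

Lemma region_cat M A B u w :
  (forall t, region M (A + na (take t (u ++ w))) (B + nb (take t (u ++ w)))) ->
  (forall t, region M (A + na (take t u)) (B + nb (take t u))) /\
  (forall t, region M (A + na u + na (take t w)) (B + nb u + nb (take t w))).
Proof.
move=> H; split=> t.
  have := H (minn t (size u)); rewrite takel_cat ?geq_minr //.
  by rewrite take_min take_size.
have := H (size u + t); rewrite takeD take_size_cat // drop_size_cat // na_cat nb_cat.
by rewrite !Z.add_assoc.
Qed.

(** Convexity of the polygon: in each range of [B] the two lines bounding it imply the others,
    through the signs of the products [G1] and [G2]. *)
Lemma region_first M A B : 0 < J -> (0 <= B <= M)%Z -> (zk * B <= A)%Z ->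
  (A <= zk * M + zn * B)%Z -> region M A B.
Proof.
move=> J0 HB H1 H2; case: (le_J J0) => kn mn.
have G1 : (0 <= (zn - zk) * (M - B))%Z by apply: Z.mul_nonneg_nonneg; lia.
have G2 : (0 <= (zn - zm) * (zJ * M - B))%Z by apply: Z.mul_nonneg_nonneg; nia.
by split=> *; lia.
Qed.

Lemma region_mid M A B : 0 < J -> (M <= B <= zJ * M)%Z ->
  (zk * M + zn * (B - M) <= A)%Z -> (A <= zk * M + zn * B)%Z -> region M A B.
Proof.
move=> J0 HB H1 H2; case: (le_J J0) => kn mn.
have G1 : (0 <= (zn - zk) * (B - M))%Z by apply: Z.mul_nonneg_nonneg; lia.
have G2 : (0 <= (zn - zm) * (zJ * M - B))%Z by apply: Z.mul_nonneg_nonneg; lia.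
by split=> *; lia.
Qed.

Lemma region_last M A B : (0 <= M)%Z -> (zJ * M <= B)%Z ->
  (zk * M + zn * (B - M) <= A)%Z -> (A <= (zk + zJ * zn) * M + zm * (B - zJ * M))%Z ->
  region M A B.
Proof.
move=> M0 HB H1 H2; case: (posnP J) => [J0|J0].
  by move: H1 H2 HB; rewrite /region (k_J0 J0) J0 => H1 H2 HB; split=> //; lia.
case: (le_J J0) => kn mn.
have G1 : (0 <= (zn - zk) * (B - M))%Z by apply: Z.mul_nonneg_nonneg; nia.
have G2 : (0 <= (zn - zm) * (B - zJ * M))%Z by apply: Z.mul_nonneg_nonneg; lia.
by split=> *; lia.
Qed.

Lemma pieces_ex N q1 q2 v : inlang N q1 q2 v -> exists p : word * word * word * word,
  let: (p1, p2, p3, p4) := p in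
  [/\ v = p1 ++ p2 ++ p3 ++ p4, nb p1 = Z.of_nat (cut1 N),
      nb p2 = (zJ * Z.of_nat N - Z.of_nat (cut1 N))%Z,
      nb p3 = Z.of_nat q2 & J = 0 -> p1 = [::] /\ p2 = [::]].
Proof.
case=> Hq _ Hb _; have cJ : cut1 N <= J * N by rewrite /cut1; case: (J) => // J'; lia.
have J0 : J = 0 -> cut1 N = 0 /\ J * N - cut1 N = 0 by rewrite /cut1 => ->; rewrite mul0n.
case: (@split_nb (cut1 N) v) => [|p1 [w1 [Ev E1 F1]]]; first by rewrite Hb; lia.
rewrite Ev nb_cat in Hb *; case: (@split_nb (J * N - cut1 N) w1) => [|p2 [w2 [E E2 F2]]].
  by lia.
rewrite E nb_cat in Hb *; case: (@split_nb q2 w2) => [|p3 [w3 [E' E3 _]]]; first by lia.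
exists (p1, p2, p3, w3); rewrite E'; split=> //; first by lia.
by move=> /J0[/F1 -> /F2 ->].
Qed.

(** Reassembles the four leftovers: the offsets of each strip are the slacks reached at the end of
    the previous pieces. *)
Lemma region_pieces (M q : Z) k0 y1 y2 y3 y4 : (0 <= M)%Z -> (0 <= q)%Z ->
  (J = 0 -> y1 = [::] /\ y2 = [::]) -> (0 < J -> nb y1 = M) ->
  (nb y1 + nb y2 = zJ * M)%Z -> nb y3 = q ->
  (na y1 + na y2 + na y3 + na y4 = (zk + zJ * zn) * M + zm * q)%Z ->
  k = 0 \/ k0 = 0%Z ->
  strip k n (k0 * M) (zk * M) y1 ->
  strip n n ((zn - zk) * M + na y1 - zn * nb y1) (zk * M + zn * nb y1 - na y1) y2 ->
  strip n m ((zn - zk) * M + na y1 + na y2 - zn * zJ * M)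
    ((zk + zJ * zn) * M - na y1 - na y2) y3 ->
  (forall t, zn * nb (take t y4) <= (zn - zk) * M + na y1 + na y2 + na y3
      - zn * (zJ * M + q) + na (take t y4))%Z ->
  forall t, region M (na (take t (y1 ++ y2 ++ y3 ++ y4))) (nb (take t (y1 ++ y2 ++ y3 ++ y4))).
Proof.
move=> M0 q0 J0y E1 E12 E3 Ea Ek T1 T2 T3 T4 t.
have b0 w s : (0 <= nb (take s w) <= nb w)%Z.
  by move: (@nb_ge0 (take s w)) (@nb_ge0 (drop s w)) (nb_take_drop s w); lia.
have Y0 s : J = 0 -> region M (na (take s [::])) (nb (take s [::])).
  move=> J0; have G : (0 <= zk * M)%Z by apply: Z.mul_nonneg_nonneg; lia.
  by rewrite /na /nb /=; split; rewrite ?(k_J0 J0) ?J0 // in G *; lia.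
case: (take_cat4 y1 y2 y3 y4 t) => t' [] ->; rewrite ?na_cat ?nb_cat.
- case: (posnP J) => [J0|J0]; first by case: (J0y J0) => -> _; apply: Y0.
  case: (T1 t') (b0 y1 t') => [T1a T1b] T1c; have e1 := E1 J0.
  apply: region_first => //; try lia.
  (* For [k = 0] the lower line only says [0 <= A], so its shift by [k0 * M] is harmless. *)
  by case: Ek T1a => [->|->]; move: (@na_ge0 (take t' y1)); lia.
- case: (posnP J) => [J0|J0]; first by case: (J0y J0) => -> ->; apply: (Y0 0).
  by case: (T2 t') (b0 y2 t') => [T2a T2b] T2c; have e1 := E1 J0; apply: region_mid => //; lia.
- by case: (T3 t') (b0 y3 t') => [T3a T3b] T3c; apply: region_last => //; lia.
move: (T4 t') (b0 y4 t') (na_take_drop t' y4) (@na_ge0 (drop t' y4)) => T4a T4b T4c T4d.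
(* In the last piece the upper bound follows from the total number of letters [a]. *)
have G : (0 <= zm * nb (take t' y4))%Z by apply: Z.mul_nonneg_nonneg; lia.
by apply: region_last => //; lia.
Qed.

(** [strip_wqo] is applied to all four pieces simultaneously; the differences of their offsets are
    those required by [region_pieces]. *)
Lemma lang_wqo (v : nat -> word) (N q1 q2 : nat -> nat) :
  (forall i, inlang (N i) (q1 i) (q2 i) (v i)) ->
  exists i j y, [/\ i < j, N i <= N j, q1 i <= q1 j, q2 i <= q2 j & shuf (v i) y (v j) /\
    inlang (N j - N i) (q1 j - q1 i) (q2 j - q2 i) y].
Proof.
move=> HL.
have [p Hp] := functional_choice _ (fun i => pieces_ex (HL i)).
pose p1 i := (p i).1.1.1; pose p2 i := (p i).1.1.2; pose p3 i := (p i).1.2; pose p4 i := (p i).2.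
have {}Hp i : [/\ v i = p1 i ++ p2 i ++ p3 i ++ p4 i, nb (p1 i) = Z.of_nat (cut1 (N i)),
      nb (p2 i) = (zJ * Z.of_nat (N i) - Z.of_nat (cut1 (N i)))%Z,
      nb (p3 i) = Z.of_nat (q2 i) & J = 0 -> p1 i = [::] /\ p2 i = [::]].
  by move: (Hp i); rewrite /p1 /p2 /p3 /p4; case: (p i) => -[[? ?] ?] ?.
have kn : k <= n by case: (posnP J) => [/k_J0->|/le_J[]].
have HJ : J = 0 /\ k = n \/ 0 < J /\ m <= n.
  by case: (posnP J) => [H|H]; [left; split=> //; exact: k_J0 | right; case: (le_J H)].
pose N' i := Z.of_nat (N i); pose c1 i := Z.of_nat (cut1 (N i)).
have c1E i : J = 0 /\ c1 i = 0%Z \/ 0 < J /\ c1 i = N' i.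
  by rewrite /c1 /N' /cut1; case: (J); [left | right].
pose k0 := if k is 0 then 1%Z else 0%Z.
have k0E : k = 0 /\ k0 = 1%Z \/ 0 < k /\ k0 = 0%Z.
  by rewrite /k0; case: (k); [left | right].
(* The bound [k B <= A] is void if [k = 0], and so is [A <= na v] in the last piece: these two lines
   are moved away by [N i], which keeps the strips at least [N i] wide. *)
pose X1 i := (k0 * N' i)%Z; pose Y1 i := (zk * N' i)%Z.
pose X2 i := ((zn - zk) * N' i + na (p1 i) - zn * c1 i)%Z.
pose Y2 i := (zk * N' i + zn * c1 i - na (p1 i))%Z.
pose X3 i := ((zn - zk) * N' i + na (p1 i) + na (p2 i) - zn * zJ * N' i)%Z.
pose Y3 i := ((zk + zJ * zn) * N' i - na (p1 i) - na (p2 i))%Z.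
pose X4 i := ((zn - zk) * N' i + na (p1 i) + na (p2 i) + na (p3 i)
  - zn * (zJ * N' i + Z.of_nat (q2 i)))%Z.
pose Y4 i := ((zk + zJ * zn) * N' i + zm * Z.of_nat (q2 i)
  - na (p1 i) - na (p2 i) - na (p3 i) + N' i)%Z.
have HR i : [/\ forall t, region (N' i) (na (take t (p1 i))) (nb (take t (p1 i))),
    forall t, region (N' i) (na (p1 i) + na (take t (p2 i))) (nb (p1 i) + nb (take t (p2 i))),
    forall t, region (N' i) (na (p1 i) + na (p2 i) + na (take t (p3 i)))
      (nb (p1 i) + nb (p2 i) + nb (take t (p3 i))) &
    forall t, region (N' i) (na (p1 i) + na (p2 i) + na (p3 i) + na (take t (p4 i)))
      (nb (p1 i) + nb (p2 i) + nb (p3 i) + nb (take t (p4 i)))].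
  case: (HL i) (Hp i) => _ _ _ H [E _ _ _ _]; rewrite E in H.
  have {}H t : region (N' i) (0 + na (take t (p1 i ++ p2 i ++ p3 i ++ p4 i)))
      (0 + nb (take t (p1 i ++ p2 i ++ p3 i ++ p4 i))) by exact: H.
  have [H1 {}H] := region_cat H; have [H2 {}H] := region_cat H.
  have [H3 {}H] := region_cat H.
  by split=> t; [move: (H1 t) | move: (H2 t) | move: (H3 t) | move: (H t)]; rewrite Z.add_0_l.
have J0nil i : J = 0 -> p1 i = [::] /\ p2 i = [::] by case: (Hp i).
have S1 i : strip k n (X1 i) (Y1 i) (p1 i).
  move=> t; case: (HR i) => /(_ t)[Q1 Q2 Q3 Q4] _ _ _.
  case: HJ => [[J0 _]|[J0 _]].
    by case: (J0nil i J0) => -> _; rewrite /na /nb /X1 /Y1 /N' /=; lia.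
  by move: (Q3 J0) Q1; rewrite /X1 /Y1 /N'; case: k0E => -[_ ->]; lia.
have S2 i : strip n n (X2 i) (Y2 i) (p2 i).
  move=> t; case: (HR i) (Hp i) => _ /(_ t)[Q1 Q2 Q3 Q4] _ _ [_ E1 _ _ _].
  rewrite /X2 /Y2 /c1 -E1; case: HJ => [[J0 kn']|[J0 _]].
    by case: (J0nil i J0) => -> ->; rewrite /na /nb /N' /= kn'; lia.
  by move: (Q3 J0) Q2; lia.
have S3 i : strip n m (X3 i) (Y3 i) (p3 i).
  move=> t; case: (HR i) (Hp i) => _ _ /(_ t)[Q1 Q2 Q3 Q4] _ [_ E1 E2 _ _].
  by move: Q2 Q4; rewrite /X3 /Y3 /N' E1 E2; lia.
have nav i : (na (p1 i) + na (p2 i) + na (p3 i) + na (p4 i) =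
    (zk + zJ * zn) * N' i + zm * Z.of_nat (q2 i))%Z.
  by case: (HL i) (Hp i) => _ <- _ _ [-> _ _ _ _]; rewrite !na_cat; lia.
have nbv i : (nb (p1 i) + nb (p2 i) + nb (p3 i) + nb (p4 i) =
    zJ * N' i + Z.of_nat (q1 i))%Z.
  by case: (HL i) (Hp i) => _ _ <- _ [-> _ _ _ _]; rewrite !nb_cat; lia.
have S4 i : strip n 0 (X4 i) (Y4 i) (p4 i).
  move=> t; case: (HR i) (Hp i) => _ _ _ /(_ t)[Q1 Q2 Q3 Q4] [_ E1 E2 E3 _].
  move: Q2 (nav i) (na_take_drop t (p4 i)) (@na_ge0 (drop t (p4 i))).
  by rewrite /X4 /Y4 /N' E1 E2 E3; lia.
(* The length of the longest copy, [x b a^m]. *)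
pose L := k + J * n + m + J + 1.
have szv i : size (p1 i) + size (p2 i) + size (p3 i) + size (p4 i) <= L * N i.
  case: (HL i) (nav i) (nbv i) => Hq _ _ _ E1 E2.
  move: (size_na_nb (p1 i)) (size_na_nb (p2 i)) (size_na_nb (p3 i)) (size_na_nb (p4 i)).
  have : (0 <= zm * (N' i - Z.of_nat (q2 i)))%Z by apply: Z.mul_nonneg_nonneg; rewrite /N'; lia.
  by rewrite /L; move: E1 E2; rewrite /N'; lia.
have Q i : q2 i <= q1 i <= N i by case: (HL i).
have nbt t w := nb_take_drop t w.
have A1 : af (fun i j => strip_le k n (X1 i) (Y1 i) (p1 i) (X1 j) (Y1 j) (p1 j)).
  apply: (@strip_wqo _ _ L _ _ _ N) => // [i t|i]; last by move: (szv i); lia.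
  have : (0 <= (zn - zk) * nb (take t (p1 i)))%Z.
    by apply: Z.mul_nonneg_nonneg; [lia | exact: nb_ge0].
  by rewrite /X1 /Y1 /N'; case: k0E => -[? ->]; nia.
have A2 : af (fun i j => strip_le n n (X2 i) (Y2 i) (p2 i) (X2 j) (Y2 j) (p2 j)).
  apply: (@strip_wqo _ _ L _ _ _ N) => // [i t|i]; last by move: (szv i); lia.
  by rewrite /X2 /Y2 /N'; nia.
have A3 : af (fun i j => strip_le n m (X3 i) (Y3 i) (p3 i) (X3 j) (Y3 j) (p3 j)).
  apply: (@strip_wqo _ _ L _ _ _ N) => // [i t|i]; last by move: (szv i); lia.
  case: (Hp i) => _ _ _ E3 _; move: (nbt t (p3 i)) (@nb_ge0 (take t (p3 i))).
  move: (@nb_ge0 (drop t (p3 i))) (Q i); set b := nb (take _ _); move=> ? ? ? ?.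
  (* The width here is [n (N - b) + m b], with [b <= q2 <= N]. *)
  have G1 : (0 <= (zn - 1) * (N' i - b))%Z by apply: Z.mul_nonneg_nonneg; rewrite /N'; lia.
  have G2 : (0 <= (zm - 1) * b)%Z by apply: Z.mul_nonneg_nonneg; lia.
  by move: G1 G2; rewrite /X3 /Y3 /N'; lia.
have A4 : af (fun i j => strip_le n 0 (X4 i) (Y4 i) (p4 i) (X4 j) (Y4 j) (p4 j)).
  apply: (@strip_wqo _ _ L _ _ _ N) => // [i t|i]; last by move: (szv i); lia.
  case: (Hp i) => _ E1 E2 E3 _; move: (nbt t (p4 i)) (@nb_ge0 (take t (p4 i))) (nbv i).
  move: (@nb_ge0 (drop t (p4 i))) (Q i); rewrite E1 E2 E3.
  set b := nb (take _ _); rewrite /N'; move=> ? ? ? ? ?.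
  (* The width here is [N + m q2 + n (N - q2 - b)], with [b <= q1 - q2]. *)
  have G1 : (0 <= zn * (N' i - b - Z.of_nat (q2 i)))%Z.
    by apply: Z.mul_nonneg_nonneg; rewrite /N'; lia.
  by move: G1; rewrite /X4 /Y4 /N'; lia.
(* Monotone differences ensure [q2 <= q1 <= N] for the leftover. *)
have B1 := af_leq (fun i => N i - q1 i).
have B2 := af_and B1 (af_and (af_leq (fun i => q1 i - q2 i)) (af_leq q2)).
case: (af_pair (af_and (af_and A1 A2) (af_and (af_and A3 A4) B2))) => i [j [ij]].
move=> [[[_ _ [y1 [Hy1 T1]]] [_ _ [y2 [Hy2 T2]]]]].
move=> [[[_ _ [y3 [Hy3 T3]]] [_ _ [y4 [Hy4 T4]]]] [C1 [C2 C3]]].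
have Qi := Q i; have Qj := Q j.
exists i, j, (y1 ++ y2 ++ y3 ++ y4); split; [by [] | lia | lia | lia |].
have Hy : shuf (v i) (y1 ++ y2 ++ y3 ++ y4) (v j).
  case: (Hp i) (Hp j) => -> _ _ _ _ [-> _ _ _ _].
  by do 3 (apply: shuf_cat => //).
have EN : Z.of_nat (N j - N i) = (N' j - N' i)%Z by rewrite /N'; lia.
have Eq1 : Z.of_nat (q1 j - q1 i) = (Z.of_nat (q1 j) - Z.of_nat (q1 i))%Z by lia.
have Eq2 : Z.of_nat (q2 j - q2 i) = (Z.of_nat (q2 j) - Z.of_nat (q2 i))%Z by lia.
split=> //; split; rewrite ?EN ?Eq1 ?Eq2; first by lia.
- by case: (HL i) (HL j) (shuf_na Hy) => _ -> _ _ [_ -> _ _]; rewrite /N'; lia.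
- by case: (HL i) (HL j) (shuf_nb Hy) => _ _ -> _ [_ _ -> _]; rewrite /N'; lia.
move: (shuf_na Hy1) (shuf_na Hy2) (shuf_na Hy3) (shuf_na Hy4) => D1 D2 D3 D4.
move: (nav i) (nav j) (nbv i) (nbv j) => F1 F2 F3 F4.
move: (shuf_nb Hy1) (shuf_nb Hy2) (shuf_nb Hy3) (shuf_nb Hy4).
case: (Hp i) (Hp j) => _ I1 I2 I3 _ [_ I1' I2' I3' _].
rewrite I1 I2 I3 I1' I2' I3' => G1 G2 G3 G4.
apply: (@region_pieces _ (Z.of_nat (q2 j) - Z.of_nat (q2 i)) k0).
- by rewrite /N'; lia.
- by lia.
- move=> J0; case: (J0nil j J0) => E1 E2; move: (shuf_size Hy1) (shuf_size Hy2).
  rewrite E1 E2 => /esym/eqP; rewrite addn_eq0 => /andP[_ /eqP/size0nil->].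
  by move=> /esym/eqP; rewrite addn_eq0 => /andP[_ /eqP/size0nil->].
- move=> J0; clear - G1 c1E J0; case: (c1E i) => -[? Ei]; first by lia.
  by case: (c1E j) => -[? Ej]; [lia | rewrite /c1 in Ei Ej; lia].
- by clear - G1 G2; rewrite /N'; lia.
- by clear - G3; lia.
- by clear - D1 D2 D3 D4 F1 F2; lia.
- by case: k0E => -[]; [left | right].
- by move: T1; congr strip; rewrite /X1 /Y1; clear; lia.
- by move: T2; congr strip; rewrite /X2 /Y2 /c1; clear - G1 D1; lia.
- by move: T3; congr strip; rewrite /X3 /Y3; clear - D1 D2; lia.
move=> t; case: (T4 t); rewrite /X4; clear - D1 D2 D3; lia.
Qed.

End Pieces.

(** * The two well quasi-orders *)

Section Wqo.
Variables (k n J m : nat).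
Hypotheses (n_gt0 : 0 < n) (m_gt0 : 0 < m).
Hypotheses (k_J0 : J = 0 -> k = n) (le_J : 0 < J -> k <= n /\ m <= n).
Local Notation x := (stem k n J).

(** The leftover again has [q2 = 0], so it is a shuffle of copies of [x] and [x b], which can be
    inserted one at a time. *)
Lemma wqo_stem_b : wqo_on (derives [:: x; x ++ [:: lb]]) (Leps [:: x; x ++ [:: lb]]).
Proof.
set I := [:: x; _] => s Hs.
have HL i : exists p : nat * nat, inlang k n J m p.1 p.2 0 (s i).
  have : exists N q1, inlang k n J m N q1 0 (s i).
    apply: (@Leps_ind I (fun v => exists N q1, inlang k n J m N q1 0 v)) (Hs i).
      by exists 0, 0; apply: inlang0.
    move=> z u v [N [q1 Hz]] [<-|[<-|//]] Hv.
      by exists (N + 1), (q1 + 0); apply: inlang_shuf Hz (inlang_stem n_gt0 m_gt0 k_J0 le_J) Hv.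
    by exists (N + 1), (q1 + 1); apply: inlang_shuf Hz (inlang_stem_b n_gt0 m_gt0 k_J0 le_J) Hv.
  by case=> N [q1 H]; exists (N, q1).
have [p Hp] := functional_choice _ HL.
case: (lang_wqo n_gt0 m_gt0 k_J0 le_J Hp) => i [j [y [ij _ _ _ [Hy Ly]]]].
exists i, j; split=> //; case: (inlang_shufs n_gt0 m_gt0 k_J0 le_J Ly) => us [Hus Hin].
apply: derives_shufs Hus _ _ _ Hy => u /Hin[[_ //]|[-> _]|[-> _]]; last by left.
by right; left.
Qed.

(** The leftover again has [q1 = N], which excludes bare copies of [x]. *)
Lemma wqo_stem_ba : wqo_on (derives [:: x ++ [:: lb]; x ++ lb :: apow m])
  (Leps [:: x ++ [:: lb]; x ++ lb :: apow m]).
Proof.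
set I := [:: _; _] => s Hs.
have HL i : exists p : nat * nat, inlang k n J m p.1 p.1 p.2 (s i).
  have : exists N q2, inlang k n J m N N q2 (s i).
    apply: (@Leps_ind I (fun v => exists N q2, inlang k n J m N N q2 v)) (Hs i).
      by exists 0, 0; apply: inlang0.
    move=> z u v [N [q2 Hz]] [<-|[<-|//]] Hv.
      by exists (N + 1), (q2 + 0); apply: inlang_shuf Hz (inlang_stem_b n_gt0 m_gt0 k_J0 le_J) Hv.
    by exists (N + 1), (q2 + 1); apply: inlang_shuf Hz (inlang_stem_ba n_gt0 m_gt0 k_J0 le_J) Hv.
  by case=> N [q2 H]; exists (N, q2).
have [p Hp] := functional_choice _ HL.
case: (lang_wqo n_gt0 m_gt0 k_J0 le_J Hp) => i [j [y [ij _ _ _ [Hy Ly]]]].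
exists i, j; split=> //; case: (inlang_shufs n_gt0 m_gt0 k_J0 le_J Ly) => us [Hus Hin].
apply: derives_shufs Hus _ _ _ Hy => u /Hin[[-> _]|[-> _]|[_]]; last by rewrite ltnn.
  by right; left.
by left.
Qed.

End Wqo.

(** If [m > n], the reversal starts with the bad factor [a^m b a^n b]. *)
Lemma good_le (n m : nat) (v : word) : 0 < n ->
  good (v ++ [:: lb] ++ apow n ++ [:: lb] ++ apow m) -> m <= n.
Proof.
move=> n0 Hgood; rewrite leqNgt; apply/negP => nm; apply: Hgood; right; left; right.
exists m, n, 1; do 3 split=> //; exists [::], (rev v).
by rewrite !rev_cat !rev_nseq -!catA.
Qed.

Theorem theorem5 (n m : nat) (w : word) :
  (1 <= n)%N -> (1 <= m)%N -> inW n w ->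
  good (w ++ apow n ++ [:: lb] ++ apow m) ->
  wqo_on (derives [:: w ++ apow n; w ++ apow n ++ [:: lb]])
         (Leps [:: w ++ apow n; w ++ apow n ++ [:: lb]]) /\
  wqo_on (derives [:: w ++ apow n ++ [:: lb]; w ++ apow n ++ [:: lb] ++ apow m])
         (Leps [:: w ++ apow n ++ [:: lb]; w ++ apow n ++ [:: lb] ++ apow m]).
Proof.
move=> n0 m0 Hw Hgood.
suff [k [J [E k_J0 le_J]]] : exists k J,
    [/\ w ++ apow n = stem k n J, J = 0 -> k = n & 0 < J -> k <= n /\ m <= n].
  rewrite !catA E; split; first exact: (wqo_stem_b n0 m0).
  by rewrite -catA; exact: (wqo_stem_ba n0 m0).
case: Hw => [->|[k [j [kn E]]]].
  by exists n, 0; split=> //; rewrite /stem /= cats0.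
(* The final [b] of [w] and the appended [a^n] form one more block. *)
exists k, j.+1; split=> //.
  by rewrite E /stem -addn1 nseqD flatten_cat /= cats0 -!catA.
split=> //; apply: (@good_le n m (apow k ++ flatten (nseq j (lb :: apow n)))) => //.
by move: Hgood; rewrite E -!catA.
Qed.
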